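(* Let $p$ be an odd prime and $q = 2^p$, and let $\mathrm{Sz}(q)$ be the Suzuki group over the field with $q$ elements. Then $|\mathrm{Solv}(\mathrm{Sz}(q))| = \frac{3q^4 + q^3 - q^2 + q}{2}$.
   Context: For a finite group $G$ and $x \in G$, the solvabilizer of $x$ in $G$ is $\mathrm{Sol}_G(x) = \{y \in G : \langle x, y \rangle \text{ is solvable}\}$. $\mathrm{Solv}(G) = \{\mathrm{Sol}_G(x) : x \in G\}$ is the set of distinct solvabilizers of elements of $G$, and $|\mathrm{Solv}(G)|$ is its cardinality. *)

(* Defs.v *)
From mathcomp Require Import all_boot all_order all_algebra all_fingroup all_solvable.
Set Implicit Arguments.
Unset Strict Implicit.
Unset Printing Implicit Defensive.
Import GRing.Theory.
Set Warnings "-ambiguous-paths -notation-overridden".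
Local Open Scope ring_scope.

Definition Sol (gT : finGroupType) (G : {set gT}) (x : gT) : {set gT} :=
  [set y in G | solvable <<[set x; y]>>%g].

Definition Solv (gT : finGroupType) (G : {set gT}) : {set {set gT}} :=
  [set Sol G x | x in G].

(* Suzuki group Sz(q), q = 2^p = 2^(2m+1) with m = (p-1)/2, over a field F
   of order q, as the subgroup of GL_4(F) generated by the standard matrices
   (R. A. Wilson, The Finite Simple Groups, 4.2):
     T(a,b), D(k) = diag(k^(1+2^m), k^(2^m), k^(-2^m), k^(-1-2^m)),
   and the antidiagonal permutation matrix W, where theta(x) = x^(2^(m+1)). *)
Section Suzuki.
Variables (F : finFieldType) (p : nat).

Definition sz_m : nat := p./2.
Definition sz_theta (x : F) : F := x ^+ (2 ^ sz_m.+1).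

Definition sz_T (a b : F) : 'M[F]_4 :=
  \matrix_(i < 4, j < 4) nth 0 (nth [::]
    [:: [:: 1; 0; 0; 0];
        [:: a; 1; 0; 0];
        [:: b; sz_theta a; 1; 0];
        [:: a ^+ 2 * sz_theta a + a * b + sz_theta b;
            a * sz_theta a + b; a; 1]] i) j.

Definition sz_D (k : F) : 'M[F]_4 :=
  diag_mx (\row_(j < 4)
    [:: k ^+ (1 + 2 ^ sz_m); k ^+ (2 ^ sz_m);
        (k ^+ (2 ^ sz_m))^-1; (k ^+ (1 + 2 ^ sz_m))^-1]`_j).

Definition sz_W : 'M[F]_4 :=
  \matrix_(i < 4, j < 4) (if (i : nat) + j == 3 then 1 else 0).

Definition sz_gen (M : 'M[F]_4) : bool :=
  [|| [exists a : F, exists b : F, M == sz_T a b],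
      [exists k : F, (k != 0) && (M == sz_D k)]
    | M == sz_W].

Definition Suzuki : {set {'GL_4[F]}} :=
  <<[set g : {'GL_4[F]} | sz_gen (GLval g)]>>%g.

End Suzuki.

(* Main.v *)
(* The group [G = Sz(q)] permutes the [q^2 + 1] conjugates of its Borel subgroup,
   the points, doubly transitively, and a nontrivial element fixes at most two
   points.  The elements with a single fixed point are 2-elements; those with two
   fixed points [P], [R] form, with 1, the torus [P :&: R] of order [q - 1]; the
   remaining ones are derangements.

   If an involution inverts a derangement [x], it inverts [A = 'C_G[x]], so [A] is
   abelian; [A] is the centraliser of each of its nontrivial elements and has index
   2 or 4 in its normaliser.  Sorting the pairs of involutions by their product
   gives [2 * \sum_x #|'C_G[x]| = q * #|G|] over these [x].  Since [#|A|] divides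
   [q^2 + 1] and there are [q^3 (q - 1)^2 / 2] derangements, this forces two classes
   of such [A], of index 4 in their normalisers and with orders of product [q^2 + 1]
   and sum [2 q + 2], and every derangement lies in one of them.  Hence there are
   [q^2 (q^2 - 1) / 2] subgroups [A].

   A solvable subgroup has a nontrivial abelian normal subgroup, so it lies in a
   point, in the normaliser of some [P :&: R] or in the normaliser of some [A].
   Therefore [Sol G x] is ['N_G(A)] for a derangement [x] of [A], and
   [P :|: R :|: 'N_G(P :&: R)] for [x != 1] in [P :&: R].  As [y \in Sol G x] is
   symmetric, this tells which elements of these two kinds lie in [Sol G x] for a
   2-element [x], enough to recover [x] up to inversion.  So [Solv G] has
   [1 + q^2 (q^2 + 1) / 2 + q^2 (q^2 - 1) / 2] elements from [x = 1] and the two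
   kinds, [(q^2 + 1) (q - 1)] from the involutions and [(q^2 + 1) (q^2 - q) / 2]
   from the elements of order 4. *)
Require Import Defs.
From mathcomp Require Import all_boot all_order all_algebra all_fingroup all_solvable.
From mathcomp Require Import finfield ring zify.
Set Implicit Arguments.
Unset Strict Implicit.
Unset Printing Implicit Defensive.

(** * Arithmetic *)

Lemma odd_sqr_succ q : ~~ odd q -> odd (q ^ 2).+1.
Proof. by move=> e; rewrite oddS oddX /= (negPf e). Qed.

Lemma sqr_succE q : 0 < q -> (q ^ 2).+1 = q.+1 * q.-1 + 2.
Proof. by case: q => // r _; rewrite -pred_Sn !expnS expn0; lia. Qed.

(** By [sqr_succE] a common factor of q^2 + 1 with q - 1 or q + 1 divides 2, and both of these
    numbers are odd. *)
Lemma coprime_sqr_succ q : 0 < q -> ~~ odd q -> coprime (q ^ 2).+1 (q ^ 2 * q.-1 * q.+1).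
Proof.
move=> q0 e; have cq : coprime (q ^ 2).+1 q.
  by rewrite coprime_sym expnS expn1 -addn1 /coprime gcdnMDl gcdn1.
rewrite !coprimeMr cq /=; apply/andP; split.
- rewrite sqr_succE // coprime_sym /coprime gcdnMDl -/(coprime _ 2) coprimen2.
  by move: e; rewrite -{1}(prednK q0) /= negbK.
- by rewrite sqr_succE // coprime_sym /coprime mulnC gcdnMDl -/(coprime _ 2) coprimen2 oddS.
Qed.

(** [a] is odd, and 3 does not divide q^2 + 1 because -1 is not a square modulo 3. *)
Lemma divisor_ge5 q a : ~~ odd q -> a %| (q ^ 2).+1 -> 1 < a -> 4 < a.
Proof.
move=> e dv a1; have oa : odd a by apply: dvdn_odd dv _; apply: odd_sqr_succ.
have : a != 3.
  apply/eqP => a3; move: dv; rewrite a3 /dvdn -addn1 -modnDml -modnXm.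
  by have := ltn_pmod q (isT : 0 < 3); case: (q %% 3) => [|[|[]]].
by move: a a1 oa {dv} => [|[|[|[|[]]]]].
Qed.

Lemma pred_sqr q : (q ^ 2).-1 = q.-1 * q.+1.
Proof. by case: q => // r; rewrite expnS expn1 mulSn addSn -!pred_Sn; lia. Qed.

Lemma mul_pred a b : 0 < a -> 0 < b -> a * b = a.-1 * b.-1 + (a + b).-1.
Proof. by case: a => // a; case: b => // b _ _; rewrite addSn /= mulSn mulnS; lia. Qed.

(** [k] will be the number of split tori and [d0] that of derangements; the last hypothesis sorts
    the elements of [G] by type. *)
Lemma arith_derangements q k d0 : (2 < q)%N -> (2 * k = (q ^ 2).+1 * q ^ 2)%N ->
  (q ^ 2 * q.-1 * (q ^ 2).+1 = 1 + (q ^ 2).+1 * (q ^ 2).-1 + k * (q - 2) + d0)%N ->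
  (2 * d0 = q ^ 3 * q.-1 ^ 2)%N.
Proof.
case: q => [|[|[|r]]] // _; rewrite (_ : r.+3 - 2 = r.+1)%N ?subSS ?subn0 //.
rewrite (_ : (r.+3 ^ 2).-1 = r.+2 * r.+4)%N; last by rewrite !expnS expn0; lia.
(* Multiplying by q - 2, here [r.+1], produces the term k (q - 2) of the other equation, so that [k]
   is eliminated linearly. *)
rewrite -pred_Sn !expnS !expn0 => /(congr1 (fun x => x * r.+1)%N) e f.
lia.
Qed.

Lemma arith_sum_cent q k c : (2 < q)%N -> (2 * k = (q ^ 2).+1 * q ^ 2)%N ->
  ((q ^ 2).+1 * q.-1 * (q ^ 2 * q.-1) = k * (q - 2) * q.-1 + c)%N ->
  (2 * c = q * (q ^ 2 * q.-1 * (q ^ 2).+1))%N.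
Proof.
case: q => [|[|[|r]]] // _; rewrite (_ : r.+3 - 2 = r.+1)%N ?subSS ?subn0 //.
rewrite -pred_Sn !expnS !expn0 => /(congr1 (fun x => x * (r.+1 * r.+2))%N) e f.
lia.
Qed.

(** If the tori formed one class, of order [a] and index [e] in the normaliser, [a] would be q + 1
    or 2 q + 1. Neither divides q^2 + 1, since q^2 + 1 = (q + 1)(q - 1) + 2 and 4 (q^2 + 1) = (2 q +
    1)(2 q - 1) + 5. *)
Lemma arith_one_class q a e : 2 < q -> a %| (q ^ 2).+1 -> e = 2 \/ e = 4 ->
  2 * a.-1 <> q * e.
Proof.
move=> q2 /dvdnP[k ak] eE ae; case: eE => eE.
  have : q.+1 %| 2.
    rewrite -(dvdn_addr _ (dvdn_mulr q.-1 (dvdnn q.+1))) -sqr_succE ?(ltnW (ltnW q2)) //.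
    by rewrite ak (_ : a = q.+1) ?dvdn_mull //; move: ak; rewrite !expnS; case: (a) ae => //; lia.
  by move/dvdn_leq => /(_ isT); lia.
have : q.*2.+1 %| 5.
  rewrite -(dvdn_addr _ (dvdn_mulr q.*2.-1 (dvdnn q.*2.+1))).
  rewrite (_ : q.*2.+1 * q.*2.-1 + 5 = 4 * (q ^ 2).+1); last first.
    by move: q2; rewrite !expnS expn0; case: (q) => // r _; rewrite doubleS -pred_Sn; lia.
  by rewrite ak (_ : a = q.*2.+1) ?mulnA ?dvdn_mull //; move: ak; rewrite !expnS;
    case: (a) ae => //; lia.
by move/dvdn_leq => /(_ isT); lia.
Qed.

(** [a] and [b] are the orders of the tori in two classes of [m] and [n] members, and [x1] counts
    the derangements outside them. Coprimality gives q^2 + 1 = c a b and counting gives 2 x1 = q^2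
    (q^2 - 1)(c - 1), so a b divides c - 1. If c > 1, then (a b)^2 < q^2 + 1, although a b > 2 q. *)
Lemma arith_two_classes q a b m n x1 d0 g :
  2 < q -> ~~ odd q -> a %| (q ^ 2).+1 -> b %| (q ^ 2).+1 -> 0 < a -> 0 < b ->
  a %| n -> 4 * a * m = g -> 4 * b * n = g -> g = q ^ 2 * q.-1 * (q ^ 2).+1 ->
  a + b = 2 * q + 2 -> 2 * d0 = q ^ 3 * q.-1 ^ 2 ->
  d0 = m * a.-1 + n * b.-1 + x1 -> a %| x1 -> b %| x1 ->
  x1 = 0 /\ 2 * (m + n) = q ^ 2 * (q ^ 2).-1.
Proof.
move=> q2 eq aM bM a0 b0 /dvdnP[k kn] am bn gE ab d0E dE ax bx.
have q0 := ltnW (ltnW q2).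
have cop := coprime_sqr_succ q0 eq.
have oa : odd a by apply: dvdn_odd aM _; apply: odd_sqr_succ.
have cab : coprime a b.
  (* A common divisor is odd and divides a + b = 2 (q + 1), while q^2 + 1 is prime to q + 1. *)
  rewrite /coprime -dvdn1; set d := gcdn a b.
  have dM : d %| (q ^ 2).+1 by apply: dvdn_trans (dvdn_gcdl _ _) aM.
  have dq : d %| 2 * q.+1.
    by rewrite mulnS addnC -ab dvdn_add ?dvdn_gcdl ?dvdn_gcdr.
  have od : odd d by apply: dvdn_odd dM _; apply: odd_sqr_succ.
  rewrite Gauss_dvdr ?coprimen2 // in dq.
  rewrite -(eqP cop) dvdn_gcd dM dvdn_mull //.
have copab : coprime (a * b) (q ^ 2 * q.-1 * q.+1).
  by rewrite coprimeMl !(coprime_dvdl _ cop).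
(* As [a] divides [n], a b divides 4 b n = g, and it is prime to the factor q^2 (q - 1) of [g]. *)
have abM : a * b %| (q ^ 2).+1.
  rewrite -(@Gauss_dvdr _ (q ^ 2 * q.-1)); last by move: copab; rewrite coprimeMr => /andP[].
  by rewrite -gE -bn kn; apply/dvdnP; exists (4 * k); clear; lia.
case/dvdnP: abM => c cM.
have c0 : 0 < c by case: (c) cM.
have ab0 : 0 < a * b by rewrite muln_gt0 a0.
have mn : 2 * (m + n) = q ^ 2 * q.-1 * q.+1 * c.
  apply/eqP; rewrite -(eqn_pmul2l (ltn0Sn 1)) -(eqn_pmul2r ab0); apply/eqP.
  transitivity (b * (4 * a * m) + a * (4 * b * n)); first by clear; lia.
  rewrite am bn gE cM -mulnDl addnC ab; clear; lia.
have x1E : 2 * x1 = q ^ 2 * q.-1 * q.+1 * c.-1.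
  have e1 : 4 * (m * a.-1 + n * b.-1) + 4 * (m + n) = 2 * g.
    suff : 4 * (m * a.-1 + n * b.-1) + 4 * (m + n) = 4 * a * m + 4 * b * n.
      by rewrite am bn => ->; rewrite mul2n addnn.
    by rewrite -(prednK a0) -(prednK b0) -!pred_Sn; clear; lia.
  move: mn e1; rewrite gE cM => mn e1.
  have : 2 * (2 * d0) = 4 * (m * a.-1 + n * b.-1) + 4 * x1 by rewrite dE; clear; lia.
  rewrite d0E => e2.
  have := cM; rewrite sqr_succE // => e3.
  move: e1 e2 e3 mn; rewrite -(prednK c0) -(prednK q0) -!pred_Sn !expnS !expn0.
  move: (m * a.-1 + n * b.-1) (m + n) (c.-1) (q.-1) => u v c' r e1 e2 e3 mn.
  have e4 : r * r.+1 * r.+1 * (c'.+1 * (a * b)) = r * r.+1 * r.+1 * (r.+2 * r + 2).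
    by rewrite e3.
  move: e1 e2 e3 e4 mn; clear; lia.
have abc : a * b %| c.-1.
  rewrite -(Gauss_dvdr _ copab) -x1E Gauss_dvd //.
  by rewrite !(dvdn_mull _ ax) // !(dvdn_mull _ bx).
have c1 : c.-1 = 0.
  apply/eqP; rewrite -leqn0 leqNgt; apply/negP => /dvdn_leq/(_ abc) le.
  have : a * b * (a * b) < (q ^ 2).+1 by rewrite cM ltn_pmul2r //; rewrite -(prednK c0) ltnS.
  have : 2 * q < a * b.
    rewrite (mul_pred a0 b0).
    by rewrite ab addn2 /= ltn_addl.
  rewrite ltnS !expnS expn0 muln1; move: (a * b) q2 => z; clear; nia.
have c_1 : c = 1 by move: c1 cM; case: (c) => [|[]].
split; first by move/eqP: x1E; rewrite c1 muln0 muln_eq0 => /eqP.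
by rewrite mn c_1 muln1 pred_sqr // mulnA.
Qed.

(** Three classes of tori would weigh at least 3 g / 5, more than half of the group. *)
Lemma arith_three_weights a b c s g : g <= 5 * c -> g <= 5 * b -> g <= 5 * a ->
  a + b + c <= s -> 2 * s < g -> False.
Proof. lia. Qed.

(** Again 2 g / 5 + g / 5 exceeds g / 2; this will exclude a torus of index 2 in its normaliser. *)
Lemma arith_two_weights a b g : 2 * g <= 5 * a -> g <= 5 * b -> 2 * (a + b) < g -> False.
Proof. lia. Qed.

(** The summands stand for x = 1, the split tori, the other tori, the involutions, and the [m] pairs
    of mutually inverse elements among the [d] of order 4. *)
Lemma arith_Solv q k a i m d : 2 < q ->
  2 * k = (q ^ 2).+1 * q ^ 2 -> 2 * a = q ^ 2 * (q ^ 2).-1 ->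
  i = (q ^ 2).+1 * q.-1 -> i + d = (q ^ 2).+1 * (q ^ 2).-1 -> d = m * 2 ->
  1 + k + a + (i + m) = (3 * q ^ 4 + q ^ 3 - q ^ 2 + q) %/ 2.
Proof.
move=> q2 kE aE iE dE mE.
suff -> : 3 * q ^ 4 + q ^ 3 - q ^ 2 + q = (1 + k + a + (i + m)) * 2 by rewrite mulnK.
(* This makes the truncated subtraction of the formula a true one. *)
have le : q ^ 2 <= 3 * q ^ 4 + q ^ 3.
  by apply: leq_trans (leq_addl _ _); rewrite leq_pexp2l // (ltnW (ltnW q2)).
apply/eqP; rewrite addnC -(eqn_add2r (q ^ 2)) -addnA subnK //; apply/eqP.
move: kE aE iE dE mE; rewrite pred_sqr => kE aE iE dE mE; move: dE; rewrite mE.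
case: q q2 kE aE iE {le mE} => // r _; rewrite -!pred_Sn !expnS !expn0; lia.
Qed.

(** * Finite sets and groups *)

Section FiniteGroups.
Import GroupScope.
Local Open Scope group_scope.

Definition involutions (gT : finGroupType) (A : {set gT}) :=
  [set t in A | (t != 1) && (t * t == 1)].
Lemma sum_disjoint_bigcup (I T : finType) (S : {set I}) (F : I -> {set T}) (f : T -> nat) :
  {in S &, forall i j x, x \in F i -> x \in F j -> i = j} ->
  (\sum_(x in \bigcup_(i in S) F i) f x = \sum_(i in S) \sum_(x in F i) f x)%N.
Proof.
move=> inj; transitivity (\sum_(x in \bigcup_(i in S) F i) \sum_(i in S | x \in F i) f x)%N.
  apply: eq_bigr => x /bigcupP[i Si Fix].
  rewrite (big_pred1 i) // => j /=; apply/andP/eqP => [[Sj Fjx]|->] //.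
  exact: inj Fjx Fix.
rewrite (exchange_big_dep (mem S)) //=; last by move=> x i _ /andP[].
apply: eq_bigr => i Si; apply: eq_bigl => x.
by rewrite Si /= andb_idl // => Fix; apply/bigcupP; exists i.
Qed.

Lemma card_bigcup_disjoint (I T : finType) (S : {set I}) (F : I -> {set T}) :
  {in S &, forall i j x, x \in F i -> x \in F j -> i = j} ->
  #|\bigcup_(i in S) F i| = \sum_(i in S) #|F i|.
Proof.
move=> inj; rewrite -sum1_card sum_disjoint_bigcup //.
by apply: eq_bigr => i _; rewrite sum1_card.
Qed.

Section Semiregular.

Variables (aT : finGroupType) (rT : finType) (to : {action aT &-> rT}).

Lemma semiregular_dvd (A : {group aT}) (S : {set rT}) :
  (forall a x, a \in A -> x \in S -> to x a \in S) ->
  (forall a x, a \in A -> x \in S -> to x a = x -> a = 1) ->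
  #|A| %| #|S|.
Proof.
move=> AS reg.
have acts : [acts A, on S | to].
  apply/subsetP => a Aa; rewrite !inE; apply/subsetP => x Sx.
  by rewrite inE AS.
rewrite -(acts_sum_card_orbit acts); apply: dvdn_sum => _ /imsetP[x Sx ->].
rewrite -(card_orbit_stab to A x) (_ : 'C_A[x | to] = 1) ?cards1 ?muln1 //.
apply/trivgP/subsetP => a /setIP[Aa /astab1P xa].
by rewrite inE (reg a x).
Qed.

End Semiregular.

(* The map [y |-> y^-1 * y ^ s] is injective on [A], hence onto. *)
Lemma regular_involution_inverts (gT : finGroupType) (A : {group gT}) (s : gT) :
  s \in 'N(A) -> s * s = 1 -> (forall y, y \in A -> commute y s -> y = 1) ->
  forall y, y \in A -> y ^ s = y^-1.
Proof.
move=> nAs ss reg y Ay.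
pose f z := z^-1 * z ^ s.
have fA : f @: A \subset A.
  by apply/subsetP => _ /imsetP[z Az ->]; rewrite groupM ?groupV // memJ_norm.
have injf : {in A &, injective f}.
  move=> a b Aa Ab /(congr1 (fun z => b * z)); rewrite /f mulKVg mulgA.
  move/(congr1 (fun z => z * (a ^ s)^-1)); rewrite mulgK -conjVg -conjMg => e.
  apply/eqP; rewrite eq_sym eq_mulgV1; apply/eqP/reg; first by rewrite groupM ?groupV.
  exact/commgP/conjg_fixP.
have : y \in f @: A.
  suff -> : f @: A = A by [].
  by apply/eqP; rewrite eqEcard fA (card_in_imset injf) leqnn.
case/imsetP=> z _ ->; rewrite /f conjMg conjVg -conjgM ss conjg1.
by rewrite [RHS]invMg invgK.
Qed.

(** Inversion is an anti-automorphism; being induced by a conjugation as well, it forces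
    commutativity. *)
Lemma inverted_abelian (gT : finGroupType) (A : {group gT}) (s : gT) :
  (forall y, y \in A -> y ^ s = y^-1) -> abelian A.
Proof.
move=> inv; apply/centsP => a Aa b Ab; rewrite /commute.
have e : (a * b) ^ s = b^-1 * a^-1 by rewrite inv ?groupM // invMg.
by apply: (conjg_inj s); rewrite e conjMg !inv.
Qed.

Lemma card_group_D1 (gT : finGroupType) (A : {group gT}) : #|A^#| = #|A|.-1.
Proof. by rewrite (cardsD1 1 A) group1. Qed.

Lemma sum_setU (T : finType) (A B : {set T}) (f : T -> nat) : [disjoint A & B] ->
  (\sum_(x in A :|: B) f x = \sum_(x in A) f x + \sum_(x in B) f x)%N.
Proof. by move=> d; rewrite -bigU //; apply: eq_bigl => x; rewrite !inE. Qed.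

Lemma card_imset_le (T U V : finType) (A : {set T}) (f : T -> U) (g : T -> V) :
  {in A &, forall x y, g x = g y -> f x = f y} -> #|f @: A| <= #|g @: A|.
Proof.
(* [h] factors [f] through [g]: it applies [f] to a chosen preimage, and is [None] on values without
   preimage in [A]. *)
move=> gf; pose h v := odflt None (omap (Some \o f) [pick x in A | g x == v]).
have injS : injective (@Some U) by move=> ? ? [].
rewrite -(card_imset _ injS); apply: leq_trans (leq_imset_card h _).
apply/subset_leq_card/subsetP => _ /imsetP[_ /imsetP[x Ax ->] ->].
apply/imsetP; exists (g x); first exact: imset_f.
rewrite /h; case: pickP => [y /andP[Ay /eqP gyx]|/(_ x)]; last by rewrite Ax eqxx.
by rewrite /= (gf y x).
Qed.

Lemma card_imset_eq (T U V : finType) (A : {set T}) (f : T -> U) (g : T -> V) :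
  {in A &, forall x y, g x = g y <-> f x = f y} -> #|f @: A| = #|g @: A|.
Proof.
move=> gf; apply/eqP; rewrite eqn_leq.
by apply/andP; split; apply: card_imset_le => x y Ax Ay; case: (gf x y Ax Ay).
Qed.

End FiniteGroups.

(** * Geometry of a split BN-pair of rank one of Suzuki type *)

Section SplitBN.
Import GroupScope.
Local Open Scope group_scope.

(** In the application [Q], [H] and [w] are given by the matrices T(a,b), D(k) and W. By [regQH] the
    group [Q * H] is a Frobenius group. *)
Variables (gT : finGroupType) (G Q H : {group gT}) (w : gT) (q : nat).
Hypotheses (q_nat : 2.-nat q) (q_gt2 : (2 < q)%N).
Hypotheses (sQG : Q \subset G) (sHG : H \subset G) (Gw : w \in G).
Hypothesis genG : G \subset <<Q :|: H :|: [set w]>>.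
Hypotheses (cardQ : #|Q| = (q ^ 2)%N) (cardH : #|H| = q.-1).
Hypotheses (nQH : H \subset 'N(Q)) (abH : abelian H).
Hypotheses (w2 : w * w = 1) (wH : forall h, h \in H -> h ^ w = h^-1).
Hypothesis regQH : forall u h, u \in Q -> h \in H -> commute u h -> u = 1 \/ h = 1.
Hypothesis tiQw : forall u, u \in Q -> u ^ w \in Q * H -> u = 1.
Hypothesis bruhat : forall u, u \in Q -> u != 1 ->
  exists b v, [/\ b \in Q * H, v \in Q & w * u * w = b * w * v].

(** From here on the hypotheses describe [Q] as a 2-group of Suzuki type. [commQ] and [no_invQ]
    serve to show that the elements of order 4 are conjugate up to inversion. *)
Hypothesis card_invQ : #|involutions Q| = q.-1.
Hypothesis cent_invQ :
  forall t u, t \in Q -> u \in Q -> t * t = 1 -> commute t u.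
Hypothesis sqQ : forall u, u \in Q -> (u * u) * (u * u) = 1.
Hypothesis sqrQ : forall u v, u \in Q -> v \in Q -> u * u = v * v ->
  (u * v^-1) * (u * v^-1) = 1.
Hypothesis commQ : forall u v, u \in Q -> v \in Q -> u * u <> 1 ->
  commute u v -> v * v = 1 \/ v * v = u * u.
Hypothesis no_invQ : forall u v, u \in Q -> v \in Q -> u * u <> 1 ->
  u ^ v <> u^-1.

Definition borel := (Q <*> H)%G.
Local Notation B := borel.
(* The points are the conjugates of [B] themselves: [G] acts on them by conjugation,
   and [x] fixes [P] iff [x \in P] (see [point_fixed]). *)
Definition points : {set {set gT}} := B :^: G.
Local Notation Om := points.

(** * The Borel subgroup and the Bruhat decomposition *)

Lemma q_gt0 : (0 < q)%N.
Proof. exact: ltnW (ltnW q_gt2). Qed.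

Lemma even_q : ~~ odd q.
Proof.
apply/negP; rewrite odd_2'nat => /(pnat_1 q_nat) q1.
by move: q_gt2; rewrite q1.
Qed.

Lemma odd_predq : odd q.-1.
Proof. by have := even_q; rewrite -{1}(prednK q_gt0) /= negbK. Qed.

Lemma borelE : B = Q * H :> {set gT}.
Proof. exact: norm_joinEr. Qed.

Lemma sQB : Q \subset B. Proof. exact: joing_subl. Qed.
Lemma sHB : H \subset B. Proof. exact: joing_subr. Qed.
Lemma sBG : B \subset G. Proof. by rewrite join_subG sQG. Qed.

Lemma tiQH : Q :&: H = 1.
Proof.
apply/trivgP/subsetP => x /setIP[xQ xH]; rewrite inE.
by case: (regQH xQ xH (commute_refl x)) => ->.
Qed.

Lemma card_borel : #|B| = (q ^ 2 * q.-1)%N.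
Proof. by rewrite borelE TI_cardMg ?tiQH // cardQ cardH. Qed.

Lemma normalQ : Q <| B.
Proof. by rewrite /normal sQB join_subG normG nQH. Qed.

(** As q - 1 is odd, [Q] is a normal Sylow 2-subgroup of [B]. This makes the unipotent radical a
    function of the point: for [P] it is ['O_2(P)]. *)
Lemma O2_borel : 'O_2(B) = Q.
Proof.
apply: normal_Hall_pcore normalQ.
rewrite /pHall sQB /pgroup cardQ pnatX q_nat /= -divgS ?sQB // card_borel cardQ.
by rewrite mulKn ?expn_gt0 ?q_gt0 // -odd_2'nat odd_predq.
Qed.

Lemma wV : w^-1 = w.
Proof. by apply/eqP; rewrite eq_invg_mul w2. Qed.

Lemma conjwE x : x ^ w = w * x * w.
Proof. by rewrite /conjg wV mulgA. Qed.

Lemma borel_conjw_trivial u : u \in Q -> u ^ w \in B -> u = 1.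
Proof. by rewrite borelE; apply: tiQw. Qed.

Lemma ntQ : exists2 u, u \in Q & u != 1.
Proof.
apply/trivgPn; rewrite trivg_card1 cardQ.
by have := q_gt2; case: (q) => [|[]].
Qed.

Lemma w_notin_borel : w \notin B.
Proof.
apply/negP => wB; have [u Qu /eqP] := ntQ; apply.
apply: borel_conjw_trivial => //; apply: (subsetP sQB).
by rewrite memJ_norm // (subsetP (normal_norm normalQ)).
Qed.

(** Induction on the length of a word in the generators: right multiplication by each of them
    preserves the union of [B] and [B * w * Q], by the hypothesis [bruhat] in the case of [w]. *)
Lemma bruhat_cells x : x \in G ->
  x \in B \/ exists b u, [/\ b \in B, u \in Q & x = b * w * u].
Proof.
move=> Gx; have /gen_prodgP[n [c cA ->]] := subsetP genG _ Gx.
elim: n c cA => [|n IHn] c cA; first by left; rewrite big_ord0.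
rewrite big_ord_recr /=.
case: (IHn (fun i => c (widen_ord (leqnSn n) i))) => [i||]; first exact: cA.
- move: (\prod_(i < n) _) (cA ord_max) => y + By.
  rewrite !inE -orbA => /or3P[Qc|Hc|/eqP ->].
  + by left; rewrite groupM // (subsetP sQB).
  + by left; rewrite groupM // (subsetP sHB).
  + by right; exists y, 1; rewrite By group1 mulg1.
case=> b [u [Bb Qu ->]].
move: (cA ord_max); rewrite !inE -orbA => /or3P[Qc|Hc|/eqP ->].
- by right; exists b, (u * c ord_max); rewrite Bb groupM // mulgA.
- right; exists (b * (c ord_max)^-1), (u ^ c ord_max); split.
  + by rewrite groupM // groupV (subsetP sHB).
  + by rewrite memJ_norm // (subsetP nQH).
  + move: (c _) Hc => h Hc.
    have <- := wH Hc; rewrite conjwE /conjg !mulgA -(mulgA _ w w) w2 mulg1.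
    by rewrite -(mulgA _ h h^-1) mulgV mulg1.
- case: (eqVneq u 1) => [->|ntu].
    by left; rewrite mulg1 -mulgA w2 mulg1.
  have [b' [v [Bb' Qv e]]] := bruhat Qu ntu.
  right; exists (b * b'), v; split=> //; first by rewrite groupM // borelE.
  by rewrite -!mulgA; congr (_ * _); rewrite !mulgA e.
Qed.

(** If some b w u normalised [B], so would [w], and then [Q :^ w] would lie in [B]. *)
Lemma norm_borel x : x \in G -> (B :^ x == B) = (x \in B).
Proof.
move=> Gx; apply/eqP/idP => [Bx|]; last exact: conjGid.
case: (bruhat_cells Gx) => // -[b [u [Bb Qu xE]]].
have Bw : B :^ w = B.
  move: Bx; rewrite xE !conjsgM (conjGid Bb) => /(congr1 (fun A => A :^ u^-1)).
  by rewrite conjsgK [RHS]conjGid // groupV (subsetP sQB).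
have [v Qv /eqP[]] := ntQ; apply: borel_conjw_trivial => //.
by rewrite -{}Bw memJ_conjg (subsetP sQB).
Qed.

(** * The points and the order of the group *)

Lemma pointsP P : P \in Om -> P = B \/ exists2 u, u \in Q & P = B :^ (w * u).
Proof.
case/imsetP=> x Gx ->; case: (bruhat_cells Gx) => [Bx|].
  by left; apply: conjGid.
case=> b [u [Bb Qu ->]]; right; exists u => //.
by rewrite -mulgA (conjsgM B b) (conjGid Bb).
Qed.

Lemma borel_point : gval B \in Om.
Proof. by apply/imsetP; exists 1; rewrite ?group1 ?conjsg1. Qed.

Lemma pointJ P x : P \in Om -> x \in G -> P :^ x \in Om.
Proof.
by case/imsetP=> g Gg -> Gx; apply/imsetP; exists (g * x); rewrite ?groupM ?conjsgM.
Qed.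

Lemma point_fixed P x : P \in Om -> x \in G -> (P :^ x == P) = (x \in P).
Proof.
case/imsetP=> g Gg -> Gx; rewrite mem_conjg -norm_borel; last by rewrite groupJ ?groupV.
by rewrite conjgE invgK !conjsgM -[RHS](inj_eq (@conjsg_inj _ g)) conjsgKV.
Qed.

Lemma point_sub P : P \in Om -> P \subset G.
Proof. by case/imsetP=> g Gg ->; rewrite -(conjGid Gg) conjSg sBG. Qed.

Lemma point_group P : P \in Om -> exists P' : {group gT}, P = P'.
Proof. by case/imsetP=> g Gg ->; exists (B :^ g)%G. Qed.

(** The points other than [B] are indexed by [Q] without repetition: if [u] and [v] gave the same
    one, [(u * v^-1) ^ w] would lie in [B]. *)
Lemma card_points : #|Om| = (q ^ 2).+1.
Proof.
have -> : Om = gval B |: [set B :^ (w * u) | u in Q].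
  apply/setP => P; rewrite !inE; apply/idP/orP => [/pointsP[->|[u Qu ->]]|].
  - by left.
  - by right; apply/imsetP; exists u.
  case=> [/eqP ->|/imsetP[u Qu ->]]; first exact: borel_point.
  by apply: pointJ borel_point _; rewrite groupM // (subsetP sQG).
rewrite cardsU1 card_in_imset ?cardQ => [|u v Qu Qv eq_uv].
  suff -> : gval B \notin [set B :^ (w * u) | u in Q] by [].
  apply/imsetP => -[u Qu /eqP]; rewrite eq_sym norm_borel; last by rewrite groupM // (subsetP sQG).
  by rewrite (groupMr _ (subsetP sQB u Qu)) (negPf w_notin_borel).
have : B :^ (w * u * (w * v)^-1) == B by rewrite conjsgM eq_uv -conjsgM mulgV conjsg1.
have Gwv z : z \in Q -> w * z \in G by move=> Qz; rewrite groupM // (subsetP sQG).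
rewrite norm_borel; last by rewrite groupM ?groupV ?Gwv.
rewrite invMg wV -!mulgA (mulgA u) mulgA -conjwE => /(borel_conjw_trivial (groupM Qu (groupVr Qv))).
by move/(canRL (mulgKV _)); rewrite mul1g.
Qed.

Lemma card_G : #|G| = (q ^ 2 * q.-1 * (q ^ 2).+1)%N.
Proof.
have NB : 'N_G(B) = B.
  apply/setP => x; rewrite inE; case Gx: (x \in G) => /=.
    by rewrite -norm_borel //; apply/normP/eqP.
  by apply/esym/negbTE/(contraFN _ Gx)/subsetP/sBG.
have := card_conjugates B G; rewrite NB -/Om card_points => i.
by rewrite -(Lagrange sBG) -i card_borel.
Qed.

(** * Double transitivity and two-point stabilisers *)

Lemma pointsT2 P R : P \in Om -> R \in Om -> P != R ->
  exists2 g, g \in G & P = B :^ g /\ R = (B :^ w) :^ g.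
Proof.
case/imsetP=> g Gg ->{P} OR neq.
case: (@pointsP (R :^ g^-1)) => [|RB|[u Qu Ru]]; first by rewrite pointJ ?groupV.
  by case/eqP: neq; rewrite -RB conjsgKV.
exists (u * g); first by rewrite groupM // (subsetP sQG).
by rewrite !(conjsgM _ u g) (conjGid (subsetP sQB u Qu)) -(conjsgM B w u) -Ru conjsgKV.
Qed.

Lemma borelI : B :&: B :^ w = H.
Proof.
apply/setP => x; rewrite inE; apply/andP/idP => [[Bx Bwx]|Hx]; last first.
  split; first exact: (subsetP sHB).
  by rewrite mem_conjg wV wH // groupV (subsetP sHB).
move: (Bx); rewrite borelE => /mulsgP[u h Qu Hh xE].
suff u1 : u = 1 by rewrite xE u1 mul1g.
apply: borel_conjw_trivial => //.
have -> : u = x * h^-1 by rewrite xE mulgK.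
rewrite conjMg conjVg (wH Hh) invgK groupM //; last exact: (subsetP sHB).
by rewrite -{1}wV -mem_conjg.
Qed.

Lemma neq_borel_w : gval B != B :^ w.
Proof. by rewrite eq_sym norm_borel // w_notin_borel. Qed.

Lemma pair_H P R : P \in Om -> R \in Om -> P != R ->
  exists2 g, g \in G & [/\ P = B :^ g, R = (B :^ w) :^ g & P :&: R = H :^ g].
Proof.
move=> OP OR neq; have [g Gg [-> ->]] := pointsT2 OP OR neq.
by exists g => //; rewrite -conjIg borelI.
Qed.

Lemma card_pair P R : P \in Om -> R \in Om -> P != R -> #|P :&: R| = q.-1.
Proof.
by move=> OP OR neq; have [g _ [_ _ ->]] := pair_H OP OR neq; rewrite cardJg.
Qed.

Lemma pair_group P R : P \in Om -> R \in Om -> P != R ->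
  exists2 K : {group gT}, P :&: R = K & abelian K.
Proof.
move=> OP OR neq; have [g _ [_ _ ->]] := pair_H OP OR neq.
by exists (H :^ g)%G; rewrite ?abelianJ.
Qed.

Lemma swap_exists P R : P \in Om -> R \in Om -> P != R ->
  exists2 s, s \in G & [/\ s * s = 1, P :^ s = R, R :^ s = P
     & forall k, k \in P :&: R -> k ^ s = k^-1].
Proof.
move=> OP OR neq; have [g Gg [-> -> ->]] := pair_H OP OR neq.
exists (w ^ g); first by rewrite groupJ.
have E (A : {set gT}) : (A :^ g) :^ (w ^ g) = (A :^ w) :^ g.
  by rewrite -!conjsgM conjgC mulgA mulgV mul1g conjsgM -conjsgM -conjgC.
split; first by rewrite -conjMg w2 conj1g.
- exact: E.
- by rewrite E -(conjsgM _ w w) w2 conjsg1.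
- by move=> k /imsetP[h Hh ->]; rewrite -conjJg wH // conjVg.
Qed.

(** [x] is a conjugate [s] of [w] times an element [k] of the abelian torus; so it acts on the torus
    as [s] does, and x^2 = k^s k = 1. *)
Lemma swap_inverts P R x : P \in Om -> R \in Om -> P != R -> x \in G ->
  P :^ x = R -> R :^ x = P ->
  x * x = 1 /\ forall k, k \in P :&: R -> k ^ x = k^-1.
Proof.
move=> OP OR neq Gx PxR RxP.
have [s Gs [ss PsR RsP sK]] := swap_exists OP OR neq.
have [K KE abK] := pair_group OP OR neq.
have sV : s^-1 = s by apply/eqP; rewrite eq_invg_mul ss.
pose k := s * x.
have Kk : k \in K.
  have Gk : s * x \in G by rewrite groupM.
  by rewrite -KE inE -(point_fixed OP Gk) -(point_fixed OR Gk) !conjsgM PsR RsP PxR RxP !eqxx.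
have xE : x = s * k by rewrite /k mulgA ss mul1g.
split.
  rewrite xE mulgA; have := sK k; rewrite KE Kk => /(_ isT).
  by rewrite /conjg sV mulgA => ->; rewrite mulVg.
move=> l; rewrite KE => Kl; rewrite xE conjgM sK ?KE // conjVg.
by rewrite /conjg (centsP abK _ Kl _ Kk) mulKg.
Qed.

(** Up to conjugacy the points are [B], [B :^ w] and [B :^ (w * u)]. Then the commutator of [u] with
    the element of [H] obtained from [x] lies in [Q :&: H], so the two commute and [regQH]
    applies. *)
Lemma third_point P R S x : P \in Om -> R \in Om -> S \in Om ->
  P != R -> P != S -> R != S -> x \in P -> x \in R -> x \in S -> x = 1.
Proof.
move=> OP OR OS PR PS RS Px Rx Sx.
have [g Gg [PE RE KE]] := pair_H OP OR PR.
have Hy : x ^ g^-1 \in H by rewrite -mem_conjg -KE inE Px.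
have : x ^ g^-1 \in S :^ g^-1 by rewrite memJ_conjg.
have {OS} : S :^ g^-1 \in Om by rewrite pointJ ?groupV.
have {PS} : S :^ g^-1 != B by rewrite (canF_eq (conjsgKV _)) -PE eq_sym.
have {RS} : S :^ g^-1 != B :^ w by rewrite (canF_eq (conjsgKV _)) -RE eq_sym.
move: (S :^ g^-1) (x ^ g^-1) Hy (conjg_eq1 x g^-1) => {Sx}S y Hy y1 neq1 neq2 OS.
case: (pointsP OS) => [SB|[u Qu SE]]; first by rewrite SB eqxx in neq2.
rewrite SE conjsgM mem_conjg => Bwy.
have Hv : y ^ u^-1 \in H.
  rewrite -borelI inE Bwy andbT groupJ ?groupV //; last exact: (subsetP sQB).
  exact: (subsetP sHB).
have yQ : y ^ u^-1 * y^-1 \in Q.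
  rewrite conjgE invgK -!mulgA -{1}(invgK y) -conjgE groupM //.
  by rewrite memJ_norm ?groupV // (subsetP nQH) ?groupV.
have : y ^ u^-1 * y^-1 \in Q :&: H by rewrite inE yQ groupM ?groupV.
rewrite tiQH inE -eq_mulgV1 => /eqP yu.
have cuy : commute u y.
  by rewrite /commute -{2}yu conjgE invgK -!mulgA mulVg mulg1.
case: (regQH Qu Hy cuy) => [u1|y_1].
  by rewrite SE u1 mulg1 eqxx in neq1.
by apply/eqP; rewrite -y1 y_1.
Qed.

(** * The 2-core of a point *)

Lemma O2_point P : P \in Om ->
  exists2 g, g \in G & P = B :^ g /\ 'O_2(P) = Q :^ g.
Proof.
by case/imsetP=> g Gg ->; exists g; rewrite // pcoreJ O2_borel.
Qed.

Lemma solvable_point P : P \in Om -> solvable P.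
Proof.
case/imsetP=> g _ ->; rewrite -(isog_sol (conj_isog B _)) (series_sol normalQ).
rewrite (pgroup_sol (p := 2)) /=; last by rewrite /pgroup cardQ pnatX q_nat.
rewrite quotientYidl // quotient_sol //; exact: abelian_sol.
Qed.

(** By [regQH] the map z -> h^z h^-1 from [Q] to itself is injective, hence onto; so every element
    of the coset of [h] is conjugate to [h]. *)
Lemma borel_conj_torus x : x \in B -> x \notin Q -> exists2 z, z \in Q & x \in H :^ z.
Proof.
rewrite {1}borelE => /mulsgP[v h Qv Hh ->] nQ.
have nth : h <> 1 by move=> h1; rewrite h1 mulg1 Qv in nQ.
pose f z := h ^ z * h^-1.
have fQ : f @: Q \subset Q.
  apply/subsetP => _ /imsetP[z Qz ->]; rewrite /f conjgE -!mulgA groupMl ?groupV //.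
  by rewrite -{1}(invgK h) -conjgE memJ_norm ?groupV // (subsetP nQH) ?groupV.
have injf : {in Q &, injective f}.
  move=> z y Qz Qy /mulIg hzy.
  have c : commute (z * y^-1) h.
    by apply/commute_sym/commgP/conjg_fixP; rewrite conjgM hzy conjgK.
  case: (regQH (groupM Qz (groupVr Qy)) Hh c) => // /eqP.
  by rewrite -eq_mulgV1 => /eqP.
have : v \in f @: Q.
  suff -> : f @: Q = Q by [].
  by apply/eqP; rewrite eqEcard fQ (card_in_imset injf) leqnn.
by case/imsetP=> z Qz ->; exists z; rewrite // /f mulgKV memJ_conjg.
Qed.

(** Moving [P] to [B] and a different [R] to [B :^ w] would put a conjugate of [x] into [Q :&: H],
    which is trivial. *)
Lemma O2_fix P R x : P \in Om -> R \in Om -> x \in 'O_2(P) -> x != 1 ->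
  x \in R -> R = P.
Proof.
move=> OP OR; have [g Gg [-> ->]] := O2_point OP.
rewrite mem_conjg -(conjg_eq1 x g^-1) -(memJ_conjg R g^-1).
move=> Qx ntx Rx; rewrite -[R](conjsgKV g); congr (_ :^ g).
have {OR} : R :^ g^-1 \in Om by rewrite pointJ ?groupV.
move: (R :^ g^-1) (x ^ g^-1) Qx ntx Rx => {}R {}x Qx ntx Rx.
case/pointsP=> [//|[u Qu RE]]; case/eqP: ntx.
apply: (conjg_inj u^-1); rewrite conj1g.
have Qxu : x ^ u^-1 \in Q by rewrite groupJ ?groupV.
apply/eqP; rewrite -in_set1 -[[set 1]]tiQH inE Qxu -borelI inE (subsetP sQB) //=.
by rewrite -mem_conjg -conjsgM -RE.
Qed.

Lemma O2_or_pair P x : P \in Om -> x \in P -> x \notin 'O_2(P) ->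
  exists2 R, R \in Om & R != P /\ x \in R.
Proof.
move=> OP; have [g Gg [-> ->]] := O2_point OP.
rewrite !(mem_conjg _ g) => Bx /(borel_conj_torus Bx)[z Qz Hx].
exists ((B :^ w) :^ (z * g)).
  by rewrite !pointJ ?borel_point ?groupM // (subsetP sQG).
split; last by rewrite conjsgM mem_conjg (subsetP _ _ Hx) // conjSg -borelI subsetIr.
rewrite conjsgM (inj_eq (@conjsg_inj _ g)).
rewrite -[X in _ != X](conjGid (subsetP sQB z Qz)) (inj_eq (@conjsg_inj _ z)).
by rewrite eq_sym neq_borel_w.
Qed.

Lemma card_O2 P : P \in Om -> #|'O_2(P)| = (q ^ 2)%N.
Proof. by case/O2_point=> g _ [_ ->]; rewrite cardJg. Qed.

Lemma card_inv_O2 P : P \in Om -> #|involutions 'O_2(P)| = q.-1.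
Proof.
case/O2_point=> g _ [_ ->]; rewrite -card_invQ -(cardJg (involutions Q) g); congr #|pred_of_set _|.
apply/setP => x; rewrite !(inE, mem_conjg) conjg_eq1; congr [&& _, _ & _].
by rewrite -conjMg conjg_eq1.
Qed.

(** An [x] commuting with [t] fixes the only point of [t]. Writing a conjugate of it as u h, the
    factor [h] commutes with the involution too, so it is 1 by [regQH]. *)
Lemma inv_cent_O2 P t x : P \in Om -> t \in involutions 'O_2(P) -> x \in G ->
  commute t x <-> x \in 'O_2(P).
Proof.
move=> OP; have [g Gg [PE OE]] := O2_point OP.
rewrite OE !inE => /and3P[Qt ntt /eqP tt] Gx; split=> [ctx|]; last first.
  rewrite !mem_conjg in Qt * => Qx; apply: (can_inj (conjgK g^-1)).
  rewrite !conjMg; apply: cent_invQ => //.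
  by rewrite -conjMg tt conj1g.
have Px : x \in P.
  rewrite -point_fixed //; apply/eqP; apply: (@O2_fix P _ t) => //.
  - exact: pointJ.
  - by rewrite OE.
  - rewrite mem_conjg (conjg_fixP _); last exact/commgP/commuteV.
    by rewrite PE (subsetP _ _ Qt) // conjSg sQB.
have ctg : commute (t ^ g^-1) (x ^ g^-1) by rewrite /commute -!conjMg ctx.
move: Px; rewrite PE !mem_conjg in Qt *.
have [] : t ^ g^-1 <> 1 /\ (t ^ g^-1) * (t ^ g^-1) = 1.
  by rewrite -conjMg tt conj1g; split=> // /eqP; rewrite conjg_eq1 (negPf ntt).
move: (t ^ _) (x ^ _) Qt ctg => {tt ctx ntt}t {Gx}x Qt ctx ntt tt.
rewrite {1}borelE => /mulsgP[u h Qu Hh xE]; rewrite xE in ctx *.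
have cth : commute t h.
  rewrite -[h](mulKg u); apply: commuteM => //.
  by apply/commuteV/cent_invQ.
by case: (regQH Qt Hh cth) => // ->; rewrite mulg1.
Qed.

Lemma O2_sq P u : P \in Om -> u \in 'O_2(P) -> (u * u) * (u * u) = 1.
Proof.
case/O2_point=> g _ [_ ->] /imsetP[v Qv ->].
by rewrite -!conjMg sqQ // conj1g.
Qed.

Lemma O2_sqr_eq P u v : P \in Om -> u \in 'O_2(P) -> v \in 'O_2(P) -> u * u = v * v ->
  (u * v^-1) * (u * v^-1) = 1.
Proof.
case/O2_point=> g _ [_ ->] /imsetP[a Qa ->] /imsetP[b Qb ->].
by rewrite -!conjVg -!conjMg => /conjg_inj/sqrQ->; rewrite ?conj1g.
Qed.

(** [Q] is a Sylow 2-subgroup, its index (q - 1)(q^2 + 1) being odd. *)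
Lemma involution_point t : t \in involutions G -> exists2 P, P \in Om & t \in 'O_2(P).
Proof.
rewrite inE => /and3P[Gt ntt /eqP tt].
have sylQ : 2.-Sylow(G) Q.
  rewrite /pHall sQG /pgroup cardQ pnatX q_nat /= -divgS ?sQG // card_G cardQ.
  rewrite -mulnA mulKn ?expn_gt0 ?q_gt0 // -odd_2'nat oddM odd_predq.
  by rewrite oddS oddX /= even_q.
have p2t : 2.-group <[t]>.
  rewrite /pgroup -orderE -(@part_pnat_id 2 #[t]) ?part_pnat //.
  by rewrite (@pnat_dvd _ 2) // order_dvdn expgS expg1 tt.
have tG : <[t]> \subset G by rewrite cycle_subG.
have [g Gg] := Sylow_subJ sylQ tG p2t; rewrite cycle_subG => Qt.
by exists (B :^ g); [rewrite pointJ ?borel_point | rewrite pcoreJ O2_borel].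
Qed.

(* The centraliser of [u] lies in the union of [Z] and [Z :* u], where [Z] is the set
   of [t] in [Q] with [t * t = 1]; so the class of [u] has at least [q / 2] elements,
   and so has the disjoint class of [u^-1], while only the [q] elements of [Z :* u]
   have the same square as [u]. *)
Lemma square_root_conj u v : u \in Q -> v \in Q -> u * u = v * v -> u * u <> 1 ->
  exists2 z, z \in Q & v = u ^ z \/ v = u^-1 ^ z.
Proof.
move=> Qu Qv uv ntu.
pose Z := [set t in Q | t * t == 1].
have cardZ : #|Z| = q.
  have -> : Z = 1 |: involutions Q.
    apply/setP => t; rewrite !inE; case: (eqVneq t 1) => [->|_] //=.
    by rewrite group1 mulg1 eqxx.
  by rewrite cardsU1 card_invQ !inE eqxx andbF /= add1n prednK ?q_gt0.
pose S := [set x in Q | x * x == u * u].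
have cardS : (#|S| <= q)%N.
  rewrite -cardZ -(card_rcoset Z u); apply/subset_leq_card/subsetP => x.
  rewrite inE => /andP[Qx /eqP xx]; rewrite mem_rcoset inE groupM ?groupV //=.
  by rewrite sqrQ.
have cls x : x \in S -> (x ^: Q \subset S) /\ (q <= 2 * #|x ^: Q|)%N.
  rewrite inE => /andP[Qx /eqP xx]; split.
    apply/subsetP => _ /imsetP[z Qz ->]; rewrite inE groupJ //= -conjMg xx.
    rewrite (conjg_fixP _) //; apply/commgP/cent_invQ => //; [exact: groupM|exact: sqQ].
  have : (#|'C_Q[x]| <= 2 * q)%N.
    have /subset_leq_card/leq_trans-> // : 'C_Q[x] \subset Z :|: Z :* x.
      apply/subsetP => y /setIP[Qy /cent1P cxy]; rewrite !inE Qy mem_rcoset inE.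
      rewrite groupM ?groupV //=.
      have ntx : x * x <> 1 by rewrite xx.
      case: (commQ Qx Qy ntx (commute_sym cxy)) => [->|yx]; first by rewrite eqxx.
      by rewrite sqrQ // eqxx orbT.
    by rewrite cardsU card_rcoset cardZ mul2n -addnn leq_subr.
  rewrite -index_cent1; have := Lagrange (subsetIl Q 'C[x]).
  rewrite cardQ -mulnn /= => ci le_c.
  by rewrite -(leq_pmul2l q_gt0) -ci mulnA (mulnC q) leq_mul2r le_c orbT.
have Su : u \in S by rewrite inE Qu eqxx.
have SuV : u^-1 \in S.
  rewrite inE groupV Qu -invMg eq_invg_mul; exact/eqP/sqQ.
have Sv : v \in S by rewrite inE Qv uv eqxx.
have [s1 c1] := cls _ Su; have [s2 c2] := cls _ SuV.
have dis : [disjoint u ^: Q & u^-1 ^: Q].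
  rewrite -setI_eq0; apply/eqP/setP => x; rewrite !inE; apply/negP => /andP[].
  case/imsetP=> a Qa -> /imsetP[b Qb] /(congr1 (fun y => y ^ b^-1)).
  rewrite conjgK -conjgM; apply: no_invQ; rewrite ?groupM ?groupV //.
have : v \in u ^: Q :|: u^-1 ^: Q.
  suff -> : u ^: Q :|: u^-1 ^: Q = S by [].
  apply/eqP; rewrite eqEcard subUset s1 s2 cardsU.
  move: dis; rewrite -setI_eq0 => /eqP->; rewrite cards0 subn0.
  move: cardS c1 c2; move: #|S| #|u ^: Q| #|u^-1 ^: Q| => a b c; clear; lia.
by case/setUP=> /imsetP[z Qz ->]; exists z; auto.
Qed.

(** Conjugate both elements into [Q]. By counting, [H] is transitive on the q - 1 involutions of
    [Q], so the squares can be made equal, and [square_root_conj] finishes. *)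
Lemma order4_conj P R u v : P \in Om -> R \in Om -> u \in 'O_2(P) -> v \in 'O_2(R) ->
  u * u <> 1 -> v * v <> 1 -> exists2 g, g \in G & v = u ^ g \/ v = u^-1 ^ g.
Proof.
case/O2_point=> a Ga [_ ->] /O2_point[b Gb [_ ->]].
case/imsetP=> x Qx -> /imsetP[y Qy ->]; rewrite -!conjMg => nx ny.
have {}nx : x * x <> 1 by move=> x1; rewrite x1 conj1g in nx.
have {}ny : y * y <> 1 by move=> y1; rewrite y1 conj1g in ny.
have Iy (z : gT) : z \in Q -> z * z <> 1 -> z * z \in involutions Q.
  by move=> Qz nz; rewrite inE groupM //= sqQ // eqxx andbT; apply/eqP.
have [h Hh xy] : exists2 h, h \in H & y * y = (x * x) ^ h.
  suff : y * y \in [set (x * x) ^ h | h in H] by case/imsetP=> h; exists h.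
  suff -> : [set (x * x) ^ h | h in H] = involutions Q by exact: Iy.
  apply/eqP; rewrite eqEcard; apply/andP; split.
    apply/subsetP => _ /imsetP[h Hh ->]; have := Iy x Qx nx.
    rewrite !inE conjg_eq1 -conjMg conjg_eq1 => /and3P[Qxx -> ->].
    by rewrite memJ_norm ?Qxx // (subsetP nQH).
  rewrite card_invQ card_in_imset ?cardH // => h k Hh Hk /(congr1 (fun y => y ^ k^-1)).
  rewrite conjgK -conjgM => /conjg_fixP/commgP c.
  case: (regQH (groupM Qx Qx) (groupM Hh (groupVr Hk)) c) => // /eqP.
  by rewrite -eq_mulgV1 => /eqP.
have Qxh : x ^ h \in Q by rewrite memJ_norm // (subsetP nQH).
have [||z Qz yE] := square_root_conj Qxh Qy; rewrite -?conjMg ?xy //.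
  by rewrite -xy.
exists (a^-1 * (h * z) * b).
  by rewrite !groupM ?groupV ?(subsetP sHG h) ?(subsetP sQG z).
case: yE => ->; [left|right].
  by rewrite !conjgM conjgK.
by rewrite -!conjVg !conjgM conjgK.
Qed.

(** * Derangements and unipotent elements *)

Definition derangements := [set x in G | [forall P in Om, x \notin P]].
Local Notation D0 := derangements.
Definition unipotents := \bigcup_(P in Om) ('O_2(P))^#.
Local Notation D1 := unipotents.
Local Notation I := (involutions G).

Lemma point1 P : P \in Om -> 1 \in P.
Proof. by case/point_group=> P' ->. Qed.

Lemma pointV P x : P \in Om -> (x^-1 \in P) = (x \in P).
Proof. by case/point_group=> P' ->; rewrite groupV. Qed.

Lemma fixed_pointJ P x y : P \in Om -> x \in G -> commute x y -> y \in P -> y \in P :^ x.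
Proof.
move=> OP Gx cxy Py; rewrite mem_conjg (conjg_fixP _) //.
exact/commgP/commuteV/commute_sym.
Qed.

Lemma O2_sub P : P \in Om -> 'O_2(P) \subset P.
Proof. by case/point_group=> P' ->; apply: pcore_sub. Qed.

Lemma O2_G P x : P \in Om -> x \in 'O_2(P) -> x \in G.
Proof. by move=> OP Ux; apply: (subsetP (point_sub OP)); apply: (subsetP (O2_sub OP)). Qed.

Lemma point_pick : exists P, P \in Om.
Proof. by apply/set0Pn; rewrite -card_gt0 card_points. Qed.

Lemma derangementG x : x \in D0 -> x \in G. Proof. by rewrite inE => /andP[]. Qed.

Lemma derangementP x P : x \in D0 -> P \in Om -> x \notin P.
Proof. by rewrite inE => /andP[_ /forall_inP h] /h. Qed.

Lemma derangement_neq1 x : x \in D0 -> x <> 1.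
Proof.
by have [P OP] := point_pick => /derangementP/(_ OP) + x1; rewrite x1 point1.
Qed.

Lemma unipotent_fix P x : P \in Om -> x \in G -> x \in D1 -> x \in P -> x \in 'O_2(P).
Proof.
move=> OP Gx /bigcupP[R OR]; rewrite !inE => /andP[ntx Ux] Px.
by rewrite (O2_fix OR OP Ux ntx Px).
Qed.

Lemma O2_unipotent P x : P \in Om -> x \in 'O_2(P) -> x != 1 -> x \in D1.
Proof. by move=> OP Ux ntx; apply/bigcupP; exists P => //; rewrite !inE ntx. Qed.

Lemma inv_unipotent t : t \in I -> t \in D1.
Proof.
move=> It; have [P OP Ut] := involution_point It.
by apply: (O2_unipotent OP Ut); move: It; rewrite inE => /and3P[].
Qed.

Lemma unipotent_nderangement x : x \in D1 -> x \notin D0.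
Proof.
case/bigcupP=> P OP; rewrite !inE => /andP[_ Ux]; rewrite negb_and.
apply/orP; right; apply/forall_inPn; exists P => //.
by rewrite negbK (subsetP (O2_sub OP)).
Qed.

(** [P :^ y] is again fixed by [x], whose only fixed point is [P]. *)
Lemma unipotent_cent_fix P x y : P \in Om -> x \in 'O_2(P) -> x != 1 -> y \in G ->
  commute x y -> y \in P.
Proof.
move=> OP Ux ntx Gy cxy; rewrite -point_fixed //; apply/eqP.
apply: (O2_fix OP (pointJ OP Gy) Ux ntx).
by apply: fixed_pointJ => //; rewrite ?(subsetP (O2_sub OP)) //; apply: commute_sym.
Qed.

Lemma pair_permute P R x y : P \in Om -> R \in Om -> P != R -> y \in P -> y \in R ->
  y != 1 -> x \in G -> y \in P :^ x -> y \in R :^ x ->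
  (P :^ x = P /\ R :^ x = R) \/ (P :^ x = R /\ R :^ x = P).
Proof.
move=> OP OR PR Py Ry nty Gx Pxy Rxy.
have PRx : P :^ x != R :^ x by rewrite (inj_eq (@conjsg_inj _ x)).
have F S : S \in Om -> y \in S -> S = P \/ S = R.
  move=> OS Sy; case: (eqVneq S P) => [|SP]; first by left.
  case: (eqVneq S R) => [|SR]; first by right.
  case/eqP: nty; apply: (third_point OP OR OS) => //; by rewrite eq_sym.
case: (F _ (pointJ OP Gx) Pxy) => E; case: (F _ (pointJ OR Gx) Rxy) => E'; auto.
  by rewrite E E' eqxx in PRx.
by rewrite E E' eqxx in PRx.
Qed.

(** Otherwise [x] would permute the one or two fixed points of [y]. Fixing one is impossible, and
    swapping two would make [x] an involution, hence unipotent. *)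
Lemma derangement_cent x y : x \in D0 -> y \in G -> y != 1 -> commute x y -> y \in D0.
Proof.
move=> Dx Gy nty cxy; rewrite inE Gy; apply/forall_inP => P OP; apply/negP => Py.
have Gx := derangementG Dx.
case: (boolP (y \in 'O_2(P))) => [Uy|nUy].
  by case/negP: (derangementP Dx OP); apply: (unipotent_cent_fix OP Uy) => //; apply: commute_sym.
have [R OR [RP Ry]] := O2_or_pair OP Py nUy.
rewrite eq_sym in RP.
have [[E _]|[E E']] := pair_permute OP OR RP Py Ry nty Gx
  (fixed_pointJ OP Gx cxy Py) (fixed_pointJ OR Gx cxy Ry).
  by case/negP: (derangementP Dx OP); rewrite -point_fixed // E.
have [xx _] := swap_inverts OP OR RP Gx E E'.
have Ix : x \in I by rewrite inE Gx xx eqxx andbT; apply/eqP/derangement_neq1.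
by have := unipotent_nderangement (inv_unipotent Ix); rewrite Dx.
Qed.

Lemma derangementJ x g : x \in D0 -> g \in G -> x ^ g \in D0.
Proof.
move=> Dx Gg; rewrite inE groupJ ?(derangementG Dx) //; apply/forall_inP => P OP.
by rewrite -mem_conjgV (derangementP Dx) // pointJ ?groupV.
Qed.

Lemma derangement_inv_commute x t : x \in D0 -> t \in I -> ~ commute x t.
Proof.
move=> Dx It c; have := unipotent_nderangement (inv_unipotent It).
move: It; rewrite inE => /and3P[Gt ntt _].
by rewrite (derangement_cent Dx Gt ntt c).
Qed.

(** * Tori: centralisers of derangements inverted by an involution *)

(** These are the strongly real derangements; [tori_structure] will show that there are no
    others. *)
Definition real_derangements := [set x in D0 | [exists t in I, x ^ t == x^-1]].
Local Notation X0 := real_derangements.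

Lemma realP x : reflect (x \in D0 /\ exists2 t, t \in I & x ^ t = x^-1) (x \in X0).
Proof.
apply: (iffP setIdP) => [[Dx /exists_inP[t It /eqP e]]|[Dx [t It e]]].
  by split=> //; exists t.
by split=> //; apply/exists_inP; exists t; rewrite ?e.
Qed.

Lemma invP t : t \in I -> [/\ t \in G, t != 1, t * t = 1 & t^-1 = t].
Proof.
rewrite inE => /and3P[Gt ntt /eqP tt]; split=> //.
by apply/eqP; rewrite eq_invg_mul tt.
Qed.

Lemma invJ t g : t \in I -> g \in G -> t ^ g \in I.
Proof.
by case/invP=> Gt ntt tt _ Gg; rewrite inE groupJ // conjg_eq1 ntt -conjMg tt conj1g /=.
Qed.

Lemma cent_derangement x y : x \in D0 -> y \in 'C_G[x] -> y != 1 -> y \in D0.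
Proof.
move=> Dx /setIP[Gy /cent1P c] nty; exact: (derangement_cent Dx).
Qed.

Lemma inv_normalizes_cent x t : x \in G -> t \in I -> x ^ t = x^-1 -> t \in 'N('C_G[x]).
Proof.
move=> Gx /invP[Gt _ _ _] e; apply/normP.
rewrite conjIg conjGid //; congr (_ :&: _).
rewrite -cent1J e; apply/setP => y.
by apply/cent1P/cent1P => /commuteV; rewrite ?invgK.
Qed.

Lemma norm_cent_inverts x t : x \in D0 -> t \in I -> t \in 'N('C_G[x]) ->
  forall y, y \in 'C_G[x] -> y ^ t = y^-1.
Proof.
move=> Dx It nt; have [Gt ntt tt _] := invP It.
apply: (regular_involution_inverts nt tt) => y Cy c.
case: (eqVneq y 1) => // nty.
by case: (derangement_inv_commute (cent_derangement Dx Cy nty) It c).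
Qed.

Lemma torus_inverted x : x \in X0 ->
  exists2 t, t \in I & t \in 'N('C_G[x]) /\ forall y, y \in 'C_G[x] -> y ^ t = y^-1.
Proof.
case/realP=> Dx [t It e]; have nt := inv_normalizes_cent (derangementG Dx) It e.
by exists t => //; split=> //; apply: norm_cent_inverts.
Qed.

Lemma torus_abelian x : x \in X0 -> abelian 'C_G[x].
Proof. by case/torus_inverted=> t _ [_ h]; apply: inverted_abelian h. Qed.

(** Centralisers of real derangements are abelian, so commuting is transitive on them; this is why
    two tori meet trivially. *)
Lemma torus_cent x y : x \in X0 -> y \in 'C_G[x] -> y != 1 -> y \in X0 /\ 'C_G[y] = 'C_G[x].
Proof.
move=> Xx Cy nty; have [Dx _] := realP _ Xx.
have Dy := cent_derangement Dx Cy nty.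
have Xy : y \in X0.
  by apply/realP; split=> //; have [t It [_ h]] := torus_inverted Xx; exists t; rewrite // h.
split=> //; have abx := torus_abelian Xx; have aby := torus_abelian Xy.
have Cx : x \in 'C_G[x] by rewrite inE (derangementG Dx) cent1id.
have Cyx : x \in 'C_G[y].
  by rewrite inE (derangementG Dx); apply/cent1P; apply: (centsP abx).
have /setIP[Gy _] := Cy.
apply/eqP; rewrite eqEsubset; apply/andP; split; apply/subsetP => z Cz.
  have /setIP[Gz _] := Cz.
  by rewrite inE Gz; apply/cent1P; apply: (centsP aby).
have /setIP[Gz _] := Cz.
by rewrite inE Gz; apply/cent1P; apply: (centsP abx).
Qed.

Lemma realJ x g : x \in X0 -> g \in G -> x ^ g \in X0.
Proof.
case/realP=> Dx [t It e] Gg; apply/realP; split; first exact: derangementJ.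
by exists (t ^ g); rewrite ?invJ // -conjJg e conjVg.
Qed.

Lemma derangement_sq x : x \in D0 -> x * x != 1.
Proof.
move=> Dx; apply/eqP => xx.
have Ix : x \in I.
  by rewrite inE (derangementG Dx) xx eqxx andbT; apply/eqP/derangement_neq1.
by have := unipotent_nderangement (inv_unipotent Ix); rewrite Dx.
Qed.

(** If [x * x] is an involution, [x] centralises it, hence lies in the 2-core containing it. *)
Lemma four_torsion_unipotent x : x \in G -> x != 1 -> (x * x) * (x * x) = 1 -> x \in D1.
Proof.
move=> Gx ntx x4; case: (eqVneq (x * x) 1) => [xx|nxx].
  by apply: inv_unipotent; rewrite inE Gx ntx xx /=.
have Ixx : x * x \in I by rewrite inE groupM // nxx x4 /=.
have [P OP Uxx] := involution_point Ixx.
have Px : x \in P.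
  by apply: (unipotent_cent_fix OP Uxx nxx Gx); apply/commute_sym/commuteM.
have Jxx : x * x \in involutions 'O_2(P) by rewrite inE Uxx nxx x4 /=.
apply: (O2_unipotent OP) => //.
by apply/(inv_cent_O2 OP Jxx Gx); apply/commute_sym/commuteM.
Qed.

(* Two involutions normalising the torus both invert it, so their product is in it. *)
Lemma torus_inv_mul x s t : x \in X0 -> s \in I -> t \in I ->
  s \in 'N('C_G[x]) -> t \in 'N('C_G[x]) -> s * t \in 'C_G[x].
Proof.
move=> Xx Is It ns nt; have [Dx _] := realP _ Xx; have Gx := derangementG Dx.
have [Gs _ _ _] := invP Is; have [Gt _ _ _] := invP It.
have Cx : x \in 'C_G[x] by rewrite inE Gx cent1id.
rewrite inE groupM //; apply/cent1P/commute_sym/commgP/conjg_fixP.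
by rewrite conjgM (norm_cent_inverts Dx Is ns Cx) conjVg (norm_cent_inverts Dx It nt Cx) invgK.
Qed.

Lemma torus_point x P y : x \in X0 -> P \in Om -> y \in 'C_G[x] -> y \in P -> y = 1.
Proof.
move=> Xx OP Cy Py; case: (eqVneq y 1) => // nty; have [Dx _] := realP _ Xx.
by have := derangementP (cent_derangement Dx Cy nty) OP; rewrite Py.
Qed.

(* Squaring maps the torus onto itself, so its inverting involutions [t] and [t ^ n]
   are conjugate under it. *)
Lemma torus_factor x t n : x \in X0 -> t \in I -> t \in 'N('C_G[x]) -> n \in 'N_G('C_G[x]) ->
  exists a c, [/\ a \in 'C_G[x], c \in 'N_G('C_G[x]), commute t c & n = c * a].
Proof.
move=> Xx It nt /setIP[Gn nn]; have [Dx _] := realP _ Xx; have [Gt ntt tt tV] := invP It.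
have ntn : t ^ n \in 'N('C_G[x]) by rewrite groupJ.
have inv := norm_cent_inverts Dx It nt.
have Cb := torus_inv_mul Xx It (invJ It Gn) nt ntn.
have sqs : t * t ^ n \in [set a * a | a in 'C_G[x]].
  suff -> : [set a * a | a in 'C_G[x]] = 'C_G[x] by [].
  apply/eqP; rewrite eqEcard; apply/andP; split.
    by apply/subsetP => _ /imsetP[a Ca ->]; rewrite groupM.
  rewrite card_in_imset // => a b Ca Cb' ab.
  have : (a * b^-1) * (a * b^-1) = 1.
    rewrite -mulgA (mulgA b^-1) (centsP (torus_abelian Xx) b^-1 _ a) ?groupV //.
    by rewrite !mulgA ab mulgK mulgV.
  have Cab : a * b^-1 \in 'C_G[x] by rewrite groupM ?groupV.
  case: (eqVneq (a * b^-1) 1) => [/eqP|nt1]; first by rewrite -eq_mulgV1 => /eqP.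
  by move/eqP: (derangement_sq (cent_derangement Dx Cab nt1)).
case/imsetP: sqs => a Ca ab.
have tn : t ^ n = t ^ a.
  have e : a^-1 ^ t = a by rewrite inv ?groupV // invgK.
  by apply: (mulgI t); rewrite ab -{1}e !conjgE tV !mulgA.
have Na : a \in 'N_G('C_G[x]).
  by apply/setIP; split; [case/setIP: Ca | rewrite (subsetP (normG _))].
exists a, (n * a^-1); split=> //.
- by rewrite groupM ?groupV // inE Gn.
- by apply/commgP/conjg_fixP; rewrite conjgM tn conjgK.
- by rewrite mulgKV.
Qed.

(** [y] lies in the 2-core ['O_2(P)] containing [t]. An involution [s] there that normalises the
    torus equals [t], because [s * t] is in the torus and fixes [P]; this applies to [y] or to
    [y * y]. *)
Lemma torus_compl x t y : x \in X0 -> t \in I -> t \in 'N('C_G[x]) ->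
  y \in 'N_G('C_G[x]) -> commute t y -> [\/ y = 1, y = t | y * y = t].
Proof.
move=> Xx It nt /setIP[Gy ny] cty; have [Gt ntt tt tV] := invP It.
have [P OP Ut] := involution_point It.
have Jt : t \in involutions 'O_2(P) by rewrite inE Ut ntt tt eqxx.
have Uy : y \in 'O_2(P) by apply/(inv_cent_O2 OP Jt Gy).
have key s : s \in I -> s \in 'N('C_G[x]) -> s \in 'O_2(P) -> s = t.
  move=> Is ns Us; have Cst := torus_inv_mul Xx Is It ns nt.
  have /eqP : s * t = 1.
    by apply: (torus_point Xx OP Cst); rewrite (subsetP (O2_sub OP)) ?groupM.
  by rewrite -{1}tV -eq_mulgV1 => /eqP.
case: (eqVneq y 1) => [->|nty]; first by constructor 1.
case: (eqVneq (y * y) 1) => [yy|nyy].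
  by constructor 2; apply: key => //; rewrite inE Gy nty yy /=.
constructor 3; apply: key; rewrite ?groupM //.
by rewrite inE groupM // nyy (O2_sq OP Uy) /=.
Qed.

(** [y * z^-1] has square 1 by [O2_sqr_eq], so it is 1 or [t] by [torus_compl]; in the second case y
    z = t z^2 = 1. *)
Lemma torus_compl4 x t y z : x \in X0 -> t \in I -> t \in 'N('C_G[x]) ->
  y \in 'N_G('C_G[x]) -> z \in 'N_G('C_G[x]) -> y * y = t -> z * z = t -> z = y \/ z = y^-1.
Proof.
move=> Xx It nt Ny Nz yt zt; have [Gt ntt tt tV] := invP It.
have [P OP Ut] := involution_point It.
have Jt : t \in involutions 'O_2(P) by rewrite inE Ut ntt tt eqxx.
have cty : commute t y by rewrite -yt; apply/commute_sym/commuteM.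
have ctz : commute t z by rewrite -zt; apply/commute_sym/commuteM.
have [Gy _] := setIP Ny; have [Gz _] := setIP Nz.
have Uy : y \in 'O_2(P) by apply/(inv_cent_O2 OP Jt Gy).
have Uz : z \in 'O_2(P) by apply/(inv_cent_O2 OP Jt Gz).
have yz : y * y = z * z by rewrite yt.
have ww := O2_sqr_eq OP Uy Uz yz.
have ctw : commute t (y * z^-1) by apply: commuteM => //; apply: commuteV.
have Nw : y * z^-1 \in 'N_G('C_G[x]) by rewrite groupM ?groupV.
case: (torus_compl Xx It nt Nw ctw) => [/eqP|yzt|].
- by rewrite -eq_mulgV1 => /eqP ->; left.
- right; apply/eqP; rewrite eq_sym eq_invg_mul; apply/eqP.
  by rewrite -[y](mulgKV z) yzt -mulgA zt.
- by rewrite ww => t1; rewrite -t1 eqxx in ntt.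
Qed.

(** Write n = c a as in [torus_factor]. If [c] is 1, [n] is in the torus. If it is [t], then n^2 =
    1, and if c^2 = t, then n^2 is [t] times an element of the torus, of square 1. *)
Lemma torus_norm x n : x \in X0 -> n \in 'N_G('C_G[x]) -> n \in 'C_G[x] \/ n \in D1.
Proof.
move=> Xx Nn; have [t It [nt inv]] := torus_inverted Xx; have [Gt ntt tt tV] := invP It.
have [a [c [Ca Nc ctc nE]]] := torus_factor Xx It nt Nn.
case: (boolP (n \in 'C_G[x])) => [|nC]; [by left | right].
have ntn : n != 1 by apply: contraNneq nC => ->; rewrite group1.
have [Gn _] := setIP Nn.
have sq b : b \in 'C_G[x] -> (t * b) * (t * b) = 1.
  move=> Cb; have -> : (t * b) * (t * b) = b ^ t * b by rewrite conjgE tV !mulgA.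
  by rewrite inv // mulVg.
apply: four_torsion_unipotent => //.
case: (torus_compl Xx It nt Nc ctc) => [c1|ct|cc].
- by case/negP: nC; rewrite nE c1 mul1g.
- by rewrite nE ct sq // mulg1.
have -> : n * n = t * (a ^ c * a) by rewrite nE -cc conjgE -!mulgA mulKVg.
by apply: sq; rewrite groupM // memJ_norm //; case/setIP: Nc.
Qed.

Lemma torus_norm_derangement x n : x \in X0 -> n \in 'N_G('C_G[x]) -> n \in D0 -> n \in 'C_G[x].
Proof.
move=> Xx Nn Dn; case: (torus_norm Xx Nn) => // /unipotent_nderangement.
by rewrite Dn.
Qed.

(** By [torus_factor] the torus is complemented in its normaliser by the centraliser [E] of [t], and
    [E] is {1, t} or {1, t, y, y^-1} according to whether [t] has a square root in the
    normaliser. *)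
Lemma card_torus_norm x : x \in X0 ->
  #|'N_G('C_G[x])| = (2 * #|'C_G[x]|)%N \/
  #|'N_G('C_G[x])| = (4 * #|'C_G[x]|)%N /\ exists2 y, y \in 'N_G('C_G[x]) & y * y \in I.
Proof.
move=> Xx; have [t It [nt inv]] := torus_inverted Xx; have [Gt ntt tt tV] := invP It.
have [Dx _] := realP _ Xx.
pose N := 'N_G('C_G[x])%G; pose E := 'C_N[t]%G.
have sCN : 'C_G[x] \subset N by rewrite subsetI subsetIl normG.
have NE : N = E * 'C_G[x] :> {set gT}.
  apply/eqP; rewrite eqEsubset mul_subG ?subsetIl // andbT.
  apply/subsetP => n Nn; have [a [c [Ca Nc ctc ->]]] := torus_factor Xx It nt Nn.
  by rewrite mem_mulg // inE Nc; apply/cent1P/commute_sym.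
have ti : E :&: 'C_G[x] = 1.
  apply/trivgP/subsetP => y /setIP[/setIP[_ /cent1P c] Cy]; rewrite inE.
  case: (eqVneq y 1) => // nty.
  by case: (derangement_inv_commute (cent_derangement Dx Cy nty) It).
have cN : #|N| = (#|E| * #|'C_G[x]|)%N by rewrite {1}NE TI_cardMg.
have Nt : t \in N by rewrite inE Gt.
have Et : t \in E by rewrite inE Nt cent1id.
have EP y : y \in E -> [\/ y = 1, y = t | y * y = t].
  case/setIP=> Ny /cent1P c; apply: (torus_compl Xx It nt Ny); exact: commute_sym.
case: (boolP [exists y in N, y * y == t]) => [/exists_inP[y Ny /eqP yt]|no].
  right; split; last by exists y; rewrite // yt.
  have Ey : y \in E by rewrite inE Ny; apply/cent1P; rewrite -yt; apply: commuteM.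
  rewrite cN; congr (_ * _)%N; have -> : E = [set 1; t; y; y^-1] :> {set gT}.
    apply/setP => z; apply/idP/idP => [Ez|].
      have Nz : z \in N by case/setIP: Ez.
      rewrite !inE -!orbA; apply/or4P.
      case: (EP z Ez) => [/eqP|/eqP|zt]; [by constructor 1 | by constructor 2 |].
      case: (torus_compl4 Xx It nt Ny Nz yt zt) => /eqP; first by constructor 3.
      by constructor 4.
    by case/setUP=> [/setUP[/set2P[]|/set1P]|/set1P] ->; rewrite ?group1 ?groupV.
  have n1 : y <> 1 by move=> y1; move: ntt; rewrite -yt y1 mulg1 eqxx.
  have n2 : y <> t by move=> y2; move: ntt; rewrite -{1}yt y2 tt eqxx.
  have n3 : y <> y^-1 by move=> y3; move: ntt; rewrite -yt {1}y3 mulVg eqxx.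
  have n4 : y^-1 <> 1 by move/eqP; rewrite invg_eq1 => /eqP.
  have n5 : y^-1 <> t by move/(congr1 (fun z => z^-1)); rewrite invgK tV.
  have /card_uniqP : uniq [:: 1; t; y; y^-1].
    rewrite /= !inE !negb_or (eq_sym 1 t) ntt !(eq_sym _ y) !(eq_sym _ y^-1).
    by do !(apply/andP; split => //); apply/eqP; auto.
  by rewrite /= => e; rewrite -[RHS]e; apply: eq_card => z; rewrite !inE -!orbA.
left; rewrite cN; congr (_ * _)%N; have -> : E = [set 1; t] :> {set gT}.
  apply/setP => z; apply/idP/idP => [Ez|]; last first.
    by case/set2P=> ->; rewrite ?group1.
  case: (EP z Ez) => [->|->|zt]; rewrite ?set21 ?set22 //.
  case/negP: no; apply/exists_inP; exists z; rewrite ?zt //.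
  by case/setIP: Ez.
by rewrite cards2 eq_sym ntt.
Qed.

(** No nontrivial element of the centraliser fixes a point, so it acts semiregularly on the
    points. *)
Lemma card_cent_dvd x : x \in D0 -> #|'C_G[x]| %| (q ^ 2).+1.
Proof.
move=> Dx; rewrite -card_points; apply: (semiregular_dvd (to := 'Js)) => [a P Ca OP|a P Ca OP Pa].
  by rewrite /= pointJ //; case/setIP: Ca.
case: (eqVneq a 1) => // nta; have := derangementP (cent_derangement Dx Ca nta) OP.
by rewrite -point_fixed ?Pa ?eqxx //; case/setIP: Ca.
Qed.

(** * Split tori and semisimple elements *)

(** With unordered pairs the intersection map is injective, so the number of split tori is a
    binomial coefficient. *)
Definition point_pairs := [set A : {set {set gT}} | A \subset Om & #|A| == 2].
Definition split_tori := [set \bigcap_(P in A) P | A : {set {set gT}} in point_pairs].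
Local Notation KK := split_tori.
Definition semisimples := \bigcup_(K in KK) K^#.
Local Notation D2 := semisimples.

Lemma bigcap_pair (P R : {set gT}) : P != R -> \bigcap_(S in [set P; R]) S = P :&: R.
Proof.
by move=> PR; rewrite big_setU1 ?inE //= big_set1.
Qed.

Lemma split_toriP K :
  reflect (exists P R, [/\ P \in Om, R \in Om, P != R & K = P :&: R]) (K \in KK).
Proof.
apply: (iffP imsetP) => [[A + ->]|[P [R [OP OR PR ->]]]].
  rewrite inE => /andP[sA /cards2P[P [R [PR AE]]]]; exists P, R.
  by rewrite AE bigcap_pair // !(subsetP sA) // AE !inE eqxx ?orbT.
exists [set P; R]; last by rewrite bigcap_pair.
by rewrite inE cards2 PR eqxx andbT subUset !sub1set OP.
Qed.

Lemma pair_fix P R S x : P \in Om -> R \in Om -> P != R -> S \in Om ->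
  x \in P -> x \in R -> x \in S -> x != 1 -> S = P \/ S = R.
Proof.
move=> OP OR PR OS Px Rx Sx ntx.
case: (eqVneq S P) => [|SP]; first by left.
case: (eqVneq S R) => [|SR]; first by right.
by case/eqP: ntx; apply: (third_point OP OR OS) => //; rewrite eq_sym.
Qed.

Lemma split_torus_inj K L x : K \in KK -> L \in KK -> x \in K^# -> x \in L^# -> K = L.
Proof.
case/split_toriP=> P [R [OP OR PR ->]] /split_toriP[P' [R' [OP' OR' PR' ->]]].
rewrite !inE => /and3P[ntx Px Rx] /and3P[_ Px' Rx'].
have [E|E] := pair_fix OP OR PR OP' Px Rx Px' ntx;
have [E'|E'] := pair_fix OP OR PR OR' Px Rx Rx' ntx; rewrite E E' // ?(setIC R) //;
by rewrite E E' eqxx in PR'.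
Qed.

Lemma split_torus_nt K : K \in KK -> exists x, x \in K^#.
Proof.
case/split_toriP=> P [R [OP OR PR ->]].
have [K' KE _] := pair_group OP OR PR; rewrite KE.
have [x Kx ntx] : exists2 x, x \in K' & x != 1.
  apply/trivgPn; rewrite trivg_card1 -KE card_pair //.
  by have := q_gt2; case: (q) => [|[|[]]].
by exists x; rewrite !inE ntx.
Qed.

Lemma card_split_tori : (2 * #|KK| = (q ^ 2).+1 * q ^ 2)%N.
Proof.
rewrite card_in_imset ?cards_draws ?card_points => [|A B].
  by rewrite mulnC; have := bin_ffact (q ^ 2).+1 2; rewrite ffactnS ffactn1 => ->.
rewrite !inE => /andP[sA /cards2P[P [R [PR AE]]]] /andP[sB /cards2P[P' [R' [PR' BE]]]].
rewrite {}AE {}BE subUset !sub1set in sA sB *; rewrite subUset !sub1set in sB.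
case/andP: sA sB => OP OR /andP[OP' OR']; rewrite !bigcap_pair // => e.
have [x] : exists x, x \in (P :&: R)^# by apply: split_torus_nt; apply/split_toriP; exists P, R.
rewrite !inE => /and3P[ntx Px Rx].
have : x \in P' :&: R' by rewrite -e inE Px.
case/setIP=> Px' Rx'.
have [E|E] := pair_fix OP OR PR OP' Px Rx Px' ntx;
have [E'|E'] := pair_fix OP OR PR OR' Px Rx Rx' ntx; rewrite E E' // ?(setUC [set R]) //;
by rewrite E E' eqxx in PR'.
Qed.

Lemma card_split_torus K : K \in KK -> #|K| = q.-1.
Proof. by case/split_toriP=> P [R [OP OR PR ->]]; apply: card_pair. Qed.

Lemma split_torus_group K : K \in KK -> exists2 K' : {group gT}, K = K' & abelian K'.
Proof. by case/split_toriP=> P [R [OP OR PR ->]]; apply: pair_group. Qed.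

Lemma semisimpleP x : reflect
  (exists P R, [/\ P \in Om, R \in Om, P != R & [/\ x \in P, x \in R & x != 1]]) (x \in D2).
Proof.
apply: (iffP bigcupP) => [[K /split_toriP[P [R [OP OR PR ->]]]]|[P [R [OP OR PR [Px Rx ntx]]]]].
  by rewrite !inE => /and3P[ntx Px Rx]; exists P, R.
exists (P :&: R); last by rewrite !inE ntx Px.
by apply/split_toriP; exists P, R.
Qed.

Lemma semisimpleG x : x \in D2 -> x \in G.
Proof. by case/semisimpleP=> P [R [OP _ _ [Px _ _]]]; apply: (subsetP (point_sub OP)). Qed.

Lemma unipotentG x : x \in D1 -> x \in G.
Proof. by case/bigcupP=> P OP; rewrite !inE => /andP[_ Ux]; apply: O2_G Ux. Qed.

Lemma semisimple_nunipotent x : x \in D2 -> x \notin D1.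
Proof.
case/semisimpleP=> P [R [OP OR PR [Px Rx ntx]]]; apply/negP => Ux.
have Gx := unipotentG Ux.
case/eqP: PR; apply/esym/(O2_fix OP OR _ ntx Rx); exact: unipotent_fix.
Qed.

Lemma semisimple_nderangement x : x \in D2 -> x \notin D0.
Proof.
case/semisimpleP=> P [R [OP OR PR [Px Rx ntx]]]; apply/negP => Dx.
by case/negP: (derangementP Dx OP).
Qed.

Lemma element_types x : x \in G -> [\/ x = 1, x \in D1, x \in D2 | x \in D0].
Proof.
move=> Gx; case: (eqVneq x 1) => [|ntx]; first by constructor 1.
case: (boolP [exists P in Om, x \in P]) => [/exists_inP[P OP Px]|no]; last first.
  by constructor 4; rewrite inE Gx -negb_exists_in.
case: (boolP (x \in 'O_2(P))) => [Ux|nUx].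
  by constructor 2; apply: O2_unipotent Ux ntx.
have [R OR [RP Rx]] := O2_or_pair OP Px nUx.
by constructor 3; apply/semisimpleP; exists R, P.
Qed.

(** * Counting the elements of each type *)

Lemma card_unipotents : #|D1| = ((q ^ 2).+1 * (q ^ 2).-1)%N.
Proof.
rewrite card_bigcup_disjoint => [|P R OP OR x]; last first.
  rewrite !inE => /andP[ntx UP] /andP[_ UR]; apply: O2_fix UR ntx _ => //.
  exact: (subsetP (O2_sub OP)).
rewrite -card_points -sum_nat_const; apply: eq_bigr => P OP.
by rewrite card_group_D1 card_O2.
Qed.

Lemma card_involutions : #|I| = ((q ^ 2).+1 * q.-1)%N.
Proof.
have -> : I = \bigcup_(P in Om) involutions 'O_2(P).
  apply/setP => t; apply/idP/bigcupP => [It|[P OP]].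
    have [P OP Ut] := involution_point It; exists P => //.
    by have [_ ntt tt _] := invP It; rewrite inE Ut ntt tt /=.
  by rewrite !inE => /andP[Ut ->]; rewrite (O2_G OP Ut).
rewrite card_bigcup_disjoint => [|P R OP OR x]; last first.
  rewrite !inE => /and3P[UP ntx _] /and3P[UR _ _]; apply: O2_fix UR ntx _ => //.
  exact: (subsetP (O2_sub OP)).
rewrite -card_points -sum_nat_const; apply: eq_bigr => P OP.
exact: card_inv_O2.
Qed.

Lemma card_semisimples : #|D2| = (#|KK| * (q - 2))%N.
Proof.
rewrite card_bigcup_disjoint => [|K L KK1 KK2 x]; last exact: split_torus_inj.
rewrite -sum_nat_const; apply: eq_bigr => K KKK.
have := card_split_torus KKK; have [K' -> _] := split_torus_group KKK.
by rewrite card_group_D1 => ->; rewrite subn2.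
Qed.

Lemma card_types : (#|G| = 1 + #|D1| + #|D2| + #|D0|)%N.
Proof.
have -> : G = [set 1] :|: (D1 :|: D2) :|: D0 :> {set gT}.
  apply/setP => x; apply/idP/idP => [Gx|].
    by case: (element_types Gx) => [->|h|h|h]; rewrite !in_setU in_set1 ?h ?eqxx ?orbT.
  case/setUP=> [/setUP[/set1P->|/setUP[]]|]; rewrite ?group1 //.
  - exact: unipotentG.
  - exact: semisimpleG.
  - exact: derangementG.
rewrite !cardsU cards1.
have -> : D1 :&: D2 = set0.
  apply/setP => x; rewrite !in_setI in_set0; apply/andP => -[h1 h2].
  by case/negP: (semisimple_nunipotent h2).
have -> : [set 1] :&: (D1 :|: D2) = set0.
  apply/setP => x; rewrite in_setI in_set1 in_set0; apply/andP => -[/eqP-> /setUP[]].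
    by case/bigcupP=> P _; rewrite !inE eqxx.
  by case/bigcupP=> P _; rewrite !inE eqxx.
have -> : ([set 1] :|: (D1 :|: D2)) :&: D0 = set0.
  apply/setP => x; rewrite in_setI in_set0; apply/andP => -[/setUP[/set1P->|/setUP[]]] h1.
  - by case: (derangement_neq1 h1).
  - by move=> h2; case/negP: (unipotent_nderangement h1).
  - by move=> h2; case/negP: (semisimple_nderangement h1).
by rewrite !cards0 !subn0 addnA.
Qed.

(** * Counting elements inverted by involutions *)

Definition inverters x := [set s in I | x ^ s == x^-1].

(** An inverting involution permutes the two fixed points of [x] and, being unipotent, cannot fix
    both. The elements swapping them form a coset of the torus and all invert it. *)
Lemma card_inverters_semisimple x : x \in D2 -> #|inverters x| = q.-1.
Proof.
case/semisimpleP=> P [R [OP OR PR [Px Rx ntx]]].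
have [s0 Gs0 [ss0 PsR RsP _]] := swap_exists OP OR PR.
rewrite -(card_pair OP OR PR) -(card_lcoset (P :&: R) s0); congr #|pred_of_set _|.
have [K KE _] := pair_group OP OR PR.
have s0V : s0^-1 = s0 by apply/eqP; rewrite eq_invg_mul ss0.
apply/setP => s; rewrite mem_lcoset s0V; apply/idP/idP => [|].
  rewrite inE => /andP[Is /eqP xs]; have [Gs nts ss sV] := invP Is.
  have Psx : x \in P :^ s by rewrite mem_conjg sV xs pointV.
  have Rsx : x \in R :^ s by rewrite mem_conjg sV xs pointV.
  have Gs0s : s0 * s \in G by rewrite groupM.
  case: (pair_permute OP OR PR Px Rx ntx Gs Psx Rsx) => -[E E'].
    have Ps : s \in P by rewrite -point_fixed // E.
    have Rs : s \in R by rewrite -point_fixed // E'.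
    have Us := unipotent_fix OP Gs (inv_unipotent Is) Ps.
    by case/eqP: PR; rewrite (O2_fix OP OR Us nts Rs).
  rewrite inE -(point_fixed OP Gs0s) -(point_fixed OR Gs0s) !conjsgM PsR RsP.
  by rewrite E E' !eqxx.
move=> Ks; have Gs : s \in G.
  rewrite -(mulKg s0 s) s0V groupM // (subsetP (point_sub OP)) //.
  by case/setIP: Ks.
have PRs0 : P :^ s = R /\ R :^ s = P.
  have [Pk Rk] := setIP Ks; have Gk : s0 * s \in G by rewrite groupM.
  move: Pk Rk; rewrite -(point_fixed OP Gk) -(point_fixed OR Gk) !conjsgM PsR RsP.
  by move=> /eqP-> /eqP->.
have [E E'] := PRs0; have [ss inv] := swap_inverts OP OR PR Gs E E'.
rewrite !inE Gs ss inv ?inE ?Px // !eqxx !andbT.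
by apply: contraNneq PR => s1; rewrite -E s1 conjsg1.
Qed.

(** The inverting involutions form the coset of the centraliser by any one of them. *)
Lemma card_inverters_real x : x \in X0 -> #|inverters x| = #|'C_G[x]|.
Proof.
move=> Xx; have [Dx [t It e]] := realP _ Xx; have [Gt ntt tt tV] := invP It.
have Gx := derangementG Dx.
rewrite -(card_lcoset 'C_G[x] t); congr #|pred_of_set _|.
have nt := inv_normalizes_cent Gx It e; have inv := norm_cent_inverts Dx It nt.
apply/setP => s; rewrite mem_lcoset tV; apply/idP/idP => [|Cs].
  rewrite inE => /andP[Is /eqP xs]; have [Gs _ _ _] := invP Is.
  rewrite inE groupM //; apply/cent1P/commute_sym/commgP/conjg_fixP.
  by rewrite conjgM e conjVg xs invgK.
have sE : s = t * (t * s) by rewrite mulgA tt mul1g.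
move: (t * s) Cs sE => c Cc ->.
have /setIP[Gc /cent1P cc] := Cc.
have xtc : x ^ (t * c) = x^-1.
  by rewrite conjgM e conjVg (conjg_fixP _) //; apply/commgP/commute_sym.
have e2 : (t * c) * (t * c) = c ^ t * c by rewrite conjgE tV !mulgA.
rewrite !inE groupM // xtc e2 inv // mulVg !eqxx !andbT.
apply/eqP => t1; move: xtc; rewrite t1 conjg1 => /eqP.
by rewrite eq_sym eq_invg_mul (negPf (derangement_sq Dx)).
Qed.

Lemma card_inverters_unreal x : x \in D0 -> x \notin X0 -> #|inverters x| = 0%N.
Proof.
move=> Dx nX; apply: eq_card0 => s; apply: contraNF nX; rewrite inE => /andP[Is /eqP e].
by apply/realP; split=> //; exists s.
Qed.

(* [x |-> s * x] maps the elements with no or exactly two fixed points that [s]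
   inverts onto the involutions fixing another point than [s]. *)
Lemma card_inverted s : s \in I ->
  #|[set x in D2 :|: D0 | x ^ s == x^-1]| = (q ^ 2 * q.-1)%N.
Proof.
move=> Is; have [Gs nts ss sV] := invP Is.
have [P OP Us] := involution_point Is.
have JI : involutions 'O_2(P) \subset I.
  by apply/subsetP => t; rewrite !inE => /andP[Ut ->]; rewrite (O2_G OP Ut).
have -> : (q ^ 2 * q.-1 = #|I :\: involutions 'O_2(P)|)%N.
  by rewrite cardsD (setIidPr JI) card_involutions card_inv_O2 // mulSn addKn.
rewrite -(card_lcoset (I :\: _) s); congr #|pred_of_set _|.
apply/setP => x; rewrite mem_lcoset sV; apply/idP/idP.
  rewrite inE => /andP[Dx /eqP xs].
  have [Gx nUx] : x \in G /\ x \notin D1.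
    case/setUP: Dx => h; first by rewrite semisimpleG // semisimple_nunipotent.
    by rewrite (derangementG h); split=> //; apply: contraL h; apply: unipotent_nderangement.
  have sx2 : (s * x) * (s * x) = 1.
    have -> : (s * x) * (s * x) = x ^ s * x by rewrite conjgE sV !mulgA.
    by rewrite xs mulVg.
  have ntsx : s * x != 1.
    apply: contraNneq nUx => sx1.
    have -> : x = s by rewrite -(mulKg s x) sx1 mulg1.
    exact: inv_unipotent.
  rewrite in_setD; apply/andP; split; last by rewrite inE groupM // ntsx sx2 /=.
  apply: contra nUx; rewrite inE => /andP[Usx _].
  have Ux : x \in 'O_2(P) by rewrite -(mulKg s x) groupM ?groupV.
  apply: (O2_unipotent OP Ux); apply/eqP => x1.
  case/setUP: Dx => [/bigcupP[K _]|/derangement_neq1 //].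
  by rewrite x1 !inE eqxx.
have xE : x = s * (s * x) by rewrite mulgA ss mul1g.
move: (s * x) xE => t -> /setDP[It nUt]; have [Gt ntt tt tV] := invP It.
have Gx : s * t \in G by rewrite groupM.
have inv : (s * t) ^ s = (s * t)^-1 by rewrite conjgE sV !mulgA ss mul1g invMg sV tV.
rewrite inE inv eqxx andbT in_setU.
case: (element_types Gx) => [/eqP st1|Ust|->|->]; rewrite ?orbT //; case/negP: nUt.
  have -> : t = s by apply/esym/eqP; rewrite eq_mulgV1 tV.
  by rewrite inE Us nts ss /=.
case/bigcupP: Ust => R OR; rewrite !inE => /andP[ntst Ust].
have Rs : s \in R.
  rewrite -point_fixed //; apply/eqP; apply: (O2_fix OR (pointJ OR Gs) Ust ntst).
  by rewrite mem_conjg sV inv pointV // (subsetP (O2_sub OR)).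
have RP := O2_fix OP OR Us nts Rs; rewrite RP in Ust.
by rewrite -(mulKg s t) sV groupM //= mulgA ss mul1g ntt tt /=.
Qed.

(* Both sides come from counting the pairs [(s, x)] such that the involution [s]
   inverts [x] and [x] has no or exactly two fixed points. *)
Lemma sum_card_cent : (2 * \sum_(x in X0) #|'C_G[x]| = q * #|G|)%N.
Proof.
pose F (s x : gT) : nat := x ^ s == x^-1.
have E : (\sum_(s in I) \sum_(x in D2 :|: D0) F s x =
          \sum_(x in D2 :|: D0) \sum_(s in I) F s x)%N by apply: exchange_big.
have L : (\sum_(s in I) \sum_(x in D2 :|: D0) F s x = #|I| * (q ^ 2 * q.-1))%N.
  rewrite -sum_nat_const; apply: eq_bigr => s Is; rewrite -(card_inverted Is).
  rewrite -sum1_card big_mkcond [RHS]big_mkcond; apply: eq_bigr => x _.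
  by rewrite /F in_set; case: (x \in D2 :|: D0); case: (_ == _).
have R : (\sum_(x in D2 :|: D0) \sum_(s in I) F s x =
          #|D2| * q.-1 + \sum_(x in X0) #|'C_G[x]|)%N.
  transitivity (\sum_(x in D2 :|: D0) #|inverters x|)%N.
    apply: eq_bigr => x _; rewrite -sum1_card big_mkcond [RHS]big_mkcond; apply: eq_bigr => s _.
    by rewrite /F /inverters in_set; case: (s \in I); case: (_ == _).
  rewrite sum_setU; last first.
    by rewrite -setI_eq0; apply/eqP/setP => x; rewrite in_setI in_set0;
      apply/andP => -[/semisimple_nderangement/negPf ->].
  congr (_ + _)%N.
    by rewrite -sum_nat_const; apply: eq_bigr => x Dx; apply: card_inverters_semisimple.
  rewrite (bigID (mem X0)) /= [X in (_ + X)%N]big1 ?addn0 => [|x /andP[Dx nX]]; last first.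
    exact: card_inverters_unreal.
  rewrite big_mkcond [RHS]big_mkcond /=; apply: eq_bigr => x _.
  case: (boolP (x \in X0)) => [Xx|_]; last by rewrite andbF.
  by have [-> _] := realP _ Xx; rewrite /= card_inverters_real.
move: E; rewrite L R card_involutions card_semisimples card_G => E.
exact: (arith_sum_cent q_gt2 card_split_tori E).
Qed.

(** * Conjugacy classes of tori *)

Definition tori := [set 'C_G[x] | x in X0].
Local Notation AA := tori.

Lemma mem_torus x : x \in X0 -> x \in 'C_G[x]^#.
Proof.
move=> Xx; have [Dx _] := realP _ Xx.
rewrite in_setD1 inE (derangementG Dx) cent1id /= andbT.
exact/eqP/derangement_neq1.
Qed.

Lemma torus_inj A B y : A \in AA -> B \in AA -> y \in A^# -> y \in B^# -> A = B.
Proof.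
case/imsetP=> a Xa -> /imsetP[b Xb ->]; rewrite !in_setD1 => /andP[nty Ay] /andP[_ By].
by have [_ <-] := torus_cent Xa Ay nty; have [_ ->] := torus_cent Xb By nty.
Qed.

Lemma realE : X0 = \bigcup_(A in AA) A^#.
Proof.
apply/setP => x; apply/idP/bigcupP => [Xx|[A /imsetP[y Xy ->]]].
  by exists 'C_G[x]; [apply: imset_f | apply: mem_torus].
by rewrite in_setD1 => /andP[ntx Cx]; have [] := torus_cent Xy Cx ntx.
Qed.

Lemma torusJ A g : A \in AA -> g \in G -> A :^ g \in AA.
Proof.
case/imsetP=> x Xx -> Gg; apply/imsetP; exists (x ^ g); first exact: realJ.
by rewrite conjIg conjGid // cent1J.
Qed.

Lemma card_real : #|X0| = (\sum_(A in AA) #|A|.-1)%N.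
Proof.
rewrite realE card_bigcup_disjoint => [|A B AA1 AA2 x]; last exact: torus_inj.
by apply: eq_bigr => A /imsetP[x _ ->]; rewrite card_group_D1.
Qed.

Lemma sum_card_tori : (2 * \sum_(A in AA) #|A|.-1 * #|A| = q * #|G|)%N.
Proof.
rewrite -sum_card_cent; congr (2 * _)%N.
rewrite realE sum_disjoint_bigcup => [|A B AA1 AA2 x]; last exact: torus_inj.
apply: eq_bigr => _ /imsetP[x Xx ->]; rewrite -card_group_D1 -sum_nat_const.
apply: eq_bigr => y; rewrite in_setD1 => /andP[nty Cy].
by have [_ ->] := torus_cent Xx Cy nty.
Qed.

Lemma torus_card_gt1 A : A \in AA -> (1 < #|A|)%N.
Proof.
case/imsetP=> x Xx ->; rewrite ltnNge -trivg_card_le1; apply/trivgPn; exists x.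
  by have := mem_torus Xx; rewrite in_setD1 => /andP[].
by have := mem_torus Xx; rewrite in_setD1 => /andP[].
Qed.

Lemma torus_card_dvd A : A \in AA -> #|A| %| (q ^ 2).+1.
Proof. by case/imsetP=> x Xx ->; apply: card_cent_dvd; case/realP: Xx. Qed.

Lemma torus_card_gt4 A : A \in AA -> (4 < #|A|)%N.
Proof.
move=> AAA; apply: divisor_ge5 even_q _ (torus_card_gt1 AAA); exact: torus_card_dvd.
Qed.

Lemma class_sum A (f : nat -> nat) : (\sum_(B in A :^: G) f #|B| = #|A :^: G| * f #|A|)%N.
Proof.
by rewrite -sum_nat_const; apply: eq_bigr => B /imsetP[g _ ->]; rewrite cardJg.
Qed.

Lemma class_sub A : A \in AA -> A :^: G \subset AA.
Proof.
by move=> AAA; apply/subsetP => B /imsetP[g Gg ->]; apply: torusJ.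
Qed.

Lemma class_card A : A \in AA ->
  (2 * #|A| * #|A :^: G| = #|G| \/ 4 * #|A| * #|A :^: G| = #|G|)%N.
Proof.
case/imsetP=> x Xx ->; have := Lagrange (subsetIl G 'N('C_G[x])); rewrite -card_conjugates.
by case: (card_torus_norm Xx) => [->|[-> _]]; [left|right].
Qed.

Lemma class_disjoint A B : B \notin A :^: G -> [disjoint A :^: G & B :^: G].
Proof.
move=> nB; rewrite -setI_eq0; apply/eqP/setP => C; rewrite in_setI in_set0.
apply/andP => -[/imsetP[g Gg ->] /imsetP[h Gh e]]; case/negP: nB.
apply/imsetP; exists (g * h^-1); rewrite ?groupM ?groupV //.
by rewrite conjsgM e conjsgK.
Qed.

(** A class of tori of order [a] contains at least |G| (a - 1) / (4 a) real derangements, and a is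
    at least 5. *)
Lemma class_weight A : A \in AA -> (#|G| <= 5 * (#|A :^: G| * #|A|.-1))%N.
Proof.
move=> AAA; have := torus_card_gt4 AAA; case: (class_card AAA) => <-.
  case: #|A| => // a; rewrite -pred_Sn ltnS => h; move: #|A :^: G| => n.
  have := leq_mul (leqnn n) h; clear; lia.
case: #|A| => // a; rewrite -pred_Sn ltnS => h; move: #|A :^: G| => n.
have := leq_mul (leqnn n) h; clear; lia.
Qed.

Lemma class_weight2 A : A \in AA -> (2 * #|A| * #|A :^: G| = #|G|)%N ->
  (2 * #|G| <= 5 * (#|A :^: G| * #|A|.-1))%N.
Proof.
move=> AAA <-; have := torus_card_gt4 AAA.
case: #|A| => // a; rewrite -pred_Sn ltnS => h; move: #|A :^: G| => n.
have := leq_mul (leqnn n) h; clear; lia.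
Qed.

Lemma card_derangements : (2 * #|D0| = q ^ 3 * q.-1 ^ 2)%N.
Proof.
have := card_types; rewrite card_G card_unipotents card_semisimples.
exact: arith_derangements q_gt2 card_split_tori.
Qed.

Lemma real_sub : X0 \subset D0.
Proof. by apply/subsetP => x /realP[]. Qed.

Lemma card_real_lt : (2 * #|X0| < #|G|)%N.
Proof.
apply: (@leq_ltn_trans (2 * #|D0|)).
  by rewrite leq_mul2l (subset_leq_card real_sub).
rewrite card_derangements card_G; move: q_gt2; case: (q) => [|[|[|r]]] // _.
rewrite -pred_Sn !expnS !expn0; lia.
Qed.

Lemma big_class_sub (S : {set {set gT}}) (f : {set gT} -> nat) :
  S \subset AA -> (\sum_(A in S) f A <= \sum_(A in AA) f A)%N.
Proof.
move=> /setIidPr <-; rewrite [leqRHS](big_setID S) /=; exact: leq_addr.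
Qed.

(** No class contradicts [sum_card_tori], one contradicts [arith_one_class], and three would contain
    more than half of [G]. *)
Lemma tori_two_classes : exists A B, [/\ A \in AA, B \in AA, B \notin A :^: G
  & AA = A :^: G :|: B :^: G].
Proof.
have [A AAA] : exists A, A \in AA.
  apply/set0Pn/eqP => A0; have := sum_card_tori; rewrite A0 big_set0 muln0 => /esym/eqP.
  by rewrite muln_eq0 eqn0Ngt q_gt0 eqn0Ngt cardG_gt0.
case: (boolP (AA \subset A :^: G)) => [sA|].
  have E : AA = A :^: G by apply/eqP; rewrite eqEsubset sA class_sub.
  have := sum_card_tori; rewrite E (class_sum A (fun a => a.-1 * a)%N) => e.
  have n0 : (0 < #|A :^: G|)%N by rewrite -E card_gt0; apply/set0Pn; exists A.
  have a0 := ltnW (torus_card_gt1 AAA).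
  have dv := torus_card_dvd AAA.
  case: (class_card AAA) => h; rewrite -h in e.
    case: (arith_one_class q_gt2 dv (or_introl (erefl _))).
    apply/eqP; rewrite -(eqn_pmul2r n0) -(eqn_pmul2r a0); apply/eqP.
    by move: e; move: #|A|.-1 #|A| #|A :^: G| => u a n; clear; lia.
  case: (arith_one_class q_gt2 dv (or_intror (erefl _))).
  apply/eqP; rewrite -(eqn_pmul2r n0) -(eqn_pmul2r a0); apply/eqP.
  by move: e; move: #|A|.-1 #|A| #|A :^: G| => u a n; clear; lia.
case/subsetPn=> B AAB nB; exists A, B; split=> //.
apply/eqP; rewrite eqEsubset subUset !class_sub // !andbT.
apply/subsetPn => -[C AAC]; rewrite in_setU negb_or => /andP[nCA nCB].
have dAB := class_disjoint nB; have dAC := class_disjoint nCA; have dBC := class_disjoint nCB.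
have := card_real_lt; rewrite card_real.
have : ((A :^: G :|: B :^: G) :|: C :^: G) \subset AA by rewrite !subUset !class_sub.
move/(big_class_sub (fun A => #|A|.-1)).
have dABC : [disjoint A :^: G :|: B :^: G & C :^: G].
  by rewrite disjoints_subset subUset -!disjoints_subset dAC.
rewrite !sum_setU // !(class_sum _ predn).
have := class_weight AAA; have := class_weight AAB; have := class_weight AAC.
exact: arith_three_weights.
Qed.

(** [A] acts semiregularly on the class of [B]: a nontrivial [a] in [A] normalising a torus [C] is a
    derangement, so it belongs to [C], whence [A] = [C]. *)
Lemma torus_class_dvd A B : A \in AA -> B \in AA -> B \notin A :^: G ->
  #|A| %| #|B :^: G|.
Proof.
move=> AAA AAB nB; have [x Xx AE] := imsetP AAA; rewrite AE.
apply: (semiregular_dvd (to := 'Js)) => [a C Ca /imsetP[g Gg ->]|a C Ca BC Cfix].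
  have [Ga _] := setIP Ca.
  by rewrite /= -conjsgM; apply/imsetP; exists (g * a); rewrite ?groupM.
case: (eqVneq a 1) => // nta; have [Ga _] := setIP Ca; have [Dx _] := realP _ Xx.
have AAC : C \in AA by apply: (subsetP (class_sub AAB)).
have [y Xy CE] := imsetP AAC.
have Na : a \in 'N_G('C_G[y]) by rewrite inE Ga -CE; apply/normP.
have Cya := torus_norm_derangement Xy Na (cent_derangement Dx Ca nta).
have AC : A = C.
  apply: (torus_inj AAA AAC (y := a)); first by rewrite AE in_setD1 nta.
  by rewrite CE in_setD1 nta.
case/imsetP: BC => g Gg; rewrite -AC => ABg; case/negP: nB.
by apply/imsetP; exists g^-1; rewrite ?groupV // ABg conjsgK.
Qed.

(** [A] acts semiregularly by conjugation, since the centraliser of a nontrivial element of [A]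
    consists of 1 and real derangements. *)
Lemma torus_unreal_dvd A : A \in AA -> #|A| %| #|D0 :\: X0|.
Proof.
move=> AAA; have [x Xx AE] := imsetP AAA; rewrite AE.
apply: (semiregular_dvd (to := 'J)) => [a y Ca /setDP[Dy nXy]|a y Ca /setDP[Dy nXy] yfix].
  have [Ga _] := setIP Ca; rewrite /= in_setD derangementJ // andbT.
  apply: contra nXy => Xya; rewrite -(conjgK a y); apply: realJ Xya _.
  by rewrite groupV.
case: (eqVneq a 1) => // nta; have [Xa Ea] := torus_cent Xx Ca nta.
have Cy : y \in 'C_G[a].
  by rewrite inE (derangementG Dy); apply/cent1P/commgP/conjg_fixP.
by have [Xy _] := torus_cent Xa Cy (introN eqP (derangement_neq1 Dy)); rewrite Xy in nXy.
Qed.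

(** Index 2 in the normaliser is excluded by weight, so both classes have index 4; this gives the
    sum of the two orders, and [arith_two_classes] applies. *)
Lemma tori_structure : [/\ D0 = X0, (2 * #|AA| = q ^ 2 * (q ^ 2).-1)%N
  & forall A, A \in AA -> (4 * #|A| * #|A :^: G| = #|G|)%N].
Proof.
have [A [B [AAA AAB nB E]]] := tori_two_classes.
have dis := class_disjoint nB.
have lt := card_real_lt.
have X0E := card_real; rewrite E sum_setU // !(class_sum _ predn) in X0E.
have wA := class_weight AAA; have wB := class_weight AAB.
have cA : (4 * #|A| * #|A :^: G| = #|G|)%N.
  case: (class_card AAA) => // h; have wA2 := class_weight2 AAA h.
  by rewrite X0E in lt; case: (arith_two_weights wA2 wB lt).
have cB : (4 * #|B| * #|B :^: G| = #|G|)%N.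
  case: (class_card AAB) => // h; have wB2 := class_weight2 AAB h.
  by rewrite X0E addnC in lt; case: (arith_two_weights wB2 wA lt).
have a0 := ltnW (torus_card_gt1 AAA); have b0 := ltnW (torus_card_gt1 AAB).
(* As both classes have index 4, [sum_card_tori] reads |G| ((a - 1) + (b - 1)) / 2 = q |G|. *)
have ab : (#|A| + #|B| = 2 * q + 2)%N.
  have := sum_card_tori; rewrite E sum_setU // !(class_sum _ (fun a => a.-1 * a)%N).
  move: cA cB (cardG_gt0 G) a0 b0; case: #|A| => // a; case: #|B| => // b.
  rewrite -!pred_Sn; move: #|A :^: G| #|B :^: G| #|G| => m n g <- e g0 _ _ h.
  have : (4 * a.+1 * m * (a + b) = 4 * a.+1 * m * (2 * q))%N.
    by move: h (congr1 (fun x => x * b)%N e); clear; lia.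
  by move/eqP; rewrite eqn_pmul2l // => /eqP; clear; lia.
have dE : (#|D0| = #|A :^: G| * #|A|.-1 + #|B :^: G| * #|B|.-1 + #|D0 :\: X0|)%N.
  by rewrite -X0E -(cardsID X0 D0) (setIidPr real_sub).
have [x10 mn] := arith_two_classes q_gt2 even_q (torus_card_dvd AAA) (torus_card_dvd AAB)
  a0 b0 (torus_class_dvd AAA AAB nB) cA cB card_G ab card_derangements dE
  (torus_unreal_dvd AAA) (torus_unreal_dvd AAB).
split.
- apply/eqP; rewrite eqEsubset real_sub andbT -setD_eq0 -cards_eq0.
  exact/eqP.
- rewrite E cardsU -mn; move: dis; rewrite -setI_eq0 => /eqP ->.
  by rewrite cards0 subn0.
- have cls S C : C \in S :^: G -> C :^: G = S :^: G.
    case/imsetP=> g Gg ->; apply/setP => K; apply/imsetP/imsetP => -[h Gh ->].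
      by exists (g * h); rewrite ?groupM ?conjsgM.
    by exists (g^-1 * h); rewrite ?groupM ?groupV // conjsgM conjsgK.
  move=> C; rewrite {1}E in_setU => /orP[] cC; rewrite (cls _ _ cC).
    by case/imsetP: cC => g _ ->; rewrite cardJg.
  by case/imsetP: cC => g _ ->; rewrite cardJg.
Qed.

(** * Solvable subgroups and solvabilizers *)

Lemma SolP x y : reflect (y \in G /\ solvable <<[set x; y]>>) (y \in Sol G x).
Proof. exact: setIdP. Qed.

Lemma Sol_sym x y : x \in G -> y \in G -> (y \in Sol G x) = (x \in Sol G y).
Proof. by move=> Gx Gy; rewrite !inE Gx Gy setUC. Qed.

Lemma SolV x : Sol G x^-1 = Sol G x.
Proof.
apply/setP => y; rewrite !inE; congr (_ && solvable _); apply/eqP.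
rewrite eqEsubset !gen_subG !subUset !sub1set; apply/andP; split; apply/andP; split.
- by rewrite groupV mem_gen ?set21.
- by rewrite mem_gen ?set22.
- by rewrite -groupV mem_gen ?set21.
- by rewrite mem_gen ?set22.
Qed.

Lemma sub_Sol (L : {group gT}) x y : solvable L -> L \subset G -> x \in L -> y \in L ->
  y \in Sol G x.
Proof.
move=> solL sLG Lx Ly; apply/SolP; split; first exact: (subsetP sLG).
by apply: (solvableS _ solL); rewrite gen_subG subUset !sub1set Lx.
Qed.

Lemma norm_split P R x : P \in Om -> R \in Om -> P != R -> x \in 'N_G(P :&: R) ->
  (P :^ x = P /\ R :^ x = R) \/ (P :^ x = R /\ R :^ x = P).
Proof.
move=> OP OR PR /setIP[Gx /normP nx].
have [k] : exists k, k \in (P :&: R)^#.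
  by apply: split_torus_nt; apply/split_toriP; exists P, R.
rewrite !inE => /and3P[ntk Pk Rk].
have /setIP[Pxk Rxk] : k \in P :^ x :&: R :^ x by rewrite -conjIg nx inE Pk.
exact: (pair_permute OP OR PR Pk Rk).
Qed.

(** Let [V] be a nontrivial abelian normal subgroup of [L]. If [V] has a unipotent element, [L]
    fixes its point. Otherwise take [v] != 1 in [V]: if it is semisimple, [V] lies in its split
    torus, which [L] normalises; if it is a derangement, [L] normalises its centraliser. *)
Lemma solvable_overgroup (L : {group gT}) : solvable L -> L \subset G -> L :!=: 1 ->
  [\/ exists2 P, P \in Om & L \subset P, exists2 K, K \in KK & L \subset 'N_G(K)
    | exists2 A, A \in AA & L \subset 'N_G(A)].
Proof.
move=> solL sLG ntL.
have [V [sVL /andP[_ nVL] ntV abV]] := solvable_norm_abelem solL (normal_refl L) ntL.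
have {abV} abV := abelem_abelian abV.
have sVG := subset_trans sVL sLG.
have VJ v h : v \in V -> h \in L -> v ^ h \in V.
  by move=> Vv Lh; rewrite memJ_norm // (subsetP nVL).
have GL h : h \in L -> h \in G by apply: (subsetP sLG).
have GV h : h \in V -> h \in G by apply: (subsetP sVG).
case: (boolP [exists v in V, v \in D1]) => [/exists_inP[v Vv /bigcupP[P OP]]|noD1].
  rewrite in_setD1 => /andP[ntv Uv]; constructor 1; exists P => //.
  apply/subsetP => h Lh; rewrite -point_fixed ?GL //; apply/eqP/esym.
  apply: (O2_fix (pointJ OP (GL _ Lh)) OP (x := v ^ h)); rewrite ?conjg_eq1 //.
    by have [P' PE] := point_group OP; rewrite PE pcoreJ memJ_conjg -PE.
  apply: (unipotent_cent_fix OP Uv) => //; first by rewrite GV ?VJ.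
  by apply: (centsP abV); rewrite ?VJ.
have nD1 v : v \in V -> v \notin D1.
  by move=> Vv; apply: contra noD1 => Dv; apply/exists_inP; exists v.
have [v Vv ntv] := trivgPn _ ntV.
case: (element_types (GV v Vv)) => [/eqP|||Dv].
- by rewrite (negPf ntv).
- by rewrite (negPf (nD1 v Vv)).
- case/semisimpleP=> P [R [OP OR PR [Pv Rv _]]]; constructor 2.
  exists (P :&: R); first by apply/split_toriP; exists P, R.
  have sVK u : u \in V -> u \in P :&: R.
    move=> Vu; have Gu := GV u Vu; have cuv := centsP abV u Vu v Vv.
    case: (pair_permute OP OR PR Pv Rv ntv Gu
      (fixed_pointJ OP Gu cuv Pv) (fixed_pointJ OR Gu cuv Rv)) => -[E E'].
      by rewrite inE -(point_fixed OP Gu) -(point_fixed OR Gu) E E' !eqxx.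
    have [uu _] := swap_inverts OP OR PR Gu E E'.
    case/negP: (nD1 u Vu); apply: four_torsion_unipotent => //; last by rewrite uu mulg1.
    by apply: contraNneq PR => u1; rewrite -E u1 conjsg1.
  apply/subsetP => h Lh; have Gh := GL h Lh; rewrite inE Gh; apply/normP; rewrite conjIg.
  have /setIP[Pvh Rvh] := sVK _ (VJ _ _ Vv Lh).
  have ntvh : v ^ h != 1 by rewrite conjg_eq1.
  case: (pair_permute OP OR PR Pvh Rvh ntvh Gh); rewrite ?memJ_conjg // => -[-> ->] //.
  exact: setIC.
have [D0X0 _ _] := tori_structure; rewrite D0X0 in Dv.
constructor 3; exists 'C_G[v]; first exact: imset_f.
apply/subsetP => h Lh; have Gh := GL h Lh; rewrite inE Gh; apply/normP.
rewrite conjIg conjGid // -cent1J.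
have Cvh : v ^ h \in 'C_G[v].
  by rewrite inE GV ?VJ //=; apply/cent1P; apply: (centsP abV); rewrite ?VJ.
by have [] := torus_cent Dv Cvh; rewrite ?conjg_eq1.
Qed.

(** The quotient by [A] has exponent dividing 4, hence is a 2-group. *)
Lemma norm_solvable (A : {group gT}) : abelian A ->
  (forall n, n \in 'N_G(A) -> (n * n) * (n * n) \in A) -> A \subset G -> solvable 'N_G(A).
Proof.
move=> abA sq sAG; have nA : A <| 'N_G(A) by rewrite normalSG.
rewrite (series_sol nA) abelian_sol //=; apply: (pgroup_sol (p := 2)).
rewrite -pnat_exponent; apply: (@pnat_dvd _ 4) => //.
apply/exponentP => _ /morphimP[n Nn NGn ->].
rewrite -morphX //; apply: coset_id.
by rewrite !expgS expg0 mulg1 !mulgA -mulgA sq.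
Qed.

Lemma torus_norm_solvable x : x \in X0 -> solvable 'N_G('C_G[x]).
Proof.
move=> Xx; apply: norm_solvable; [exact: torus_abelian | | exact: subsetIl].
move=> n Nn; case: (torus_norm Xx Nn) => [Cn|/bigcupP[P OP]].
  by rewrite !groupM.
by rewrite in_setD1 => /andP[_ Un]; rewrite (O2_sq OP Un) group1.
Qed.

Lemma split_norm_solvable K : K \in KK -> solvable 'N_G(K).
Proof.
move=> KKK; have [K' KE abK] := split_torus_group KKK.
have [P [R [OP OR PR KE']]] := split_toriP _ KKK.
rewrite KE; apply: norm_solvable => // [n|]; last first.
  by rewrite -KE KE' subIset // point_sub.
rewrite -KE KE' => Nn; have Gn : n \in G by case/setIP: Nn.
case: (norm_split OP OR PR Nn) => -[E E']; last first.
  by have [-> _] := swap_inverts OP OR PR Gn E E'; rewrite mulg1 -KE' KE group1.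
rewrite -KE' KE !groupM // -KE KE' inE -(point_fixed OP Gn) -(point_fixed OR Gn) E E';
by rewrite !eqxx.
Qed.

(** Of the three overgroups only the normaliser of a torus is possible: [x] fixes no point, and
    swapping two points would give x^2 = 1. A derangement in such a normaliser lies in the torus. *)
Lemma Sol_derangement x : x \in X0 -> Sol G x = 'N_G('C_G[x]).
Proof.
move=> Xx; have [Dx _] := realP _ Xx; have Gx := derangementG Dx.
apply/setP => y; apply/idP/idP => [/SolP[Gy sol]|Ny]; last first.
  apply: (sub_Sol (torus_norm_solvable Xx)); rewrite ?subsetIl //.
  rewrite inE Gx (subsetP (normG _)) // inE Gx cent1id //.
have Hx : x \in <<[set x; y]>> by rewrite mem_gen ?set21.
have Hy : y \in <<[set x; y]>> by rewrite mem_gen ?set22.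
have sLG : <<[set x; y]>> \subset G by rewrite gen_subG subUset !sub1set Gx.
have ntH : <<[set x; y]>> != 1.
  by apply/trivgPn; exists x => //; apply/eqP/derangement_neq1.
case: (solvable_overgroup sol sLG ntH) => [[P OP sHP]|[K KKK sHN]|[A AAA sHN]].
- by case/negP: (derangementP Dx OP); apply: (subsetP sHP).
- have [P [R [OP OR PR KE]]] := split_toriP _ KKK; rewrite KE in sHN.
  case: (norm_split OP OR PR (subsetP sHN _ Hx)) => -[E E'].
    by case/negP: (derangementP Dx OP); rewrite -(point_fixed OP Gx) E.
  have [xx _] := swap_inverts OP OR PR Gx E E'.
  by have := derangement_sq Dx; rewrite xx eqxx.
- case/imsetP: AAA sHN => z Xz -> sHN.
  have Cx := torus_norm_derangement Xz (subsetP sHN _ Hx) Dx.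
  have [|_ ->] := torus_cent Xz Cx; first exact/eqP/derangement_neq1.
  exact: (subsetP sHN).
Qed.

(** The normaliser of a torus is excluded here, since its nontrivial elements are derangements or
    unipotent. *)
Lemma Sol_semisimple P R x : P \in Om -> R \in Om -> P != R -> x \in P -> x \in R ->
  x != 1 -> Sol G x = P :|: R :|: 'N_G(P :&: R).
Proof.
move=> OP OR PR Px Rx ntx; have Gx : x \in G by apply: (subsetP (point_sub OP)).
have Dx : x \in D2 by apply/semisimpleP; exists P, R.
have KKK : P :&: R \in KK by apply/split_toriP; exists P, R.
have [K KE abK] := pair_group OP OR PR.
have Kx : x \in 'N_G(P :&: R).
  rewrite inE Gx KE (subsetP (normG _)) // -KE inE Px //.
have pt S y : S \in Om -> x \in S -> y \in S -> y \in Sol G x.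
  move=> OS Sx Sy; have [S' SE] := point_group OS.
  by apply: (@sub_Sol S'); rewrite -SE ?solvable_point ?point_sub.
apply/setP => y; apply/idP/idP => [/SolP[Gy sol]|]; last first.
  case/setUP=> [/setUP[]|Ny]; [exact: pt|exact: pt|].
  have := split_norm_solvable KKK; rewrite KE in Ny Kx * => sol.
  by apply: (sub_Sol sol); rewrite ?subsetIl.
have Hx : x \in <<[set x; y]>> by rewrite mem_gen ?set21.
have Hy : y \in <<[set x; y]>> by rewrite mem_gen ?set22.
have sLG : <<[set x; y]>> \subset G by rewrite gen_subG subUset !sub1set Gx.
have ntH : <<[set x; y]>> != 1 by apply/trivgPn; exists x.
case: (solvable_overgroup sol sLG ntH) => [[S OS sHS]|[L KKL sHN]|[A AAA sHN]].
- have Sx := subsetP sHS _ Hx; have Sy := subsetP sHS _ Hy.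
  by case: (pair_fix OP OR PR OS Px Rx Sx ntx) => E; rewrite E in Sy; rewrite !in_setU Sy ?orbT.
- have [S [T [OS OT ST LE]]] := split_toriP _ KKL; rewrite LE in sHN.
  case: (norm_split OS OT ST (subsetP sHN _ Hx)) => -[E E']; last first.
    have [xx _] := swap_inverts OS OT ST Gx E E'.
    have Ix : x \in I by rewrite inE Gx ntx xx eqxx.
    by case/negP: (semisimple_nunipotent Dx); apply: inv_unipotent.
  have KL : P :&: R = L.
    apply: (split_torus_inj (x := x) KKK KKL); first by rewrite !inE ntx Px.
    by rewrite LE !inE ntx -(point_fixed OS Gx) -(point_fixed OT Gx) E E' !eqxx.
  by rewrite in_setU KL LE (subsetP sHN) ?orbT.
- case/imsetP: AAA sHN => z Xz -> sHN; have [Dz _] := realP _ Xz.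
  case: (torus_norm Xz (subsetP sHN _ Hx)) => [Cx|Ux].
    by have := semisimple_nderangement Dx; rewrite (cent_derangement Dz Cx ntx).
  by case/negP: (semisimple_nunipotent Dx).
Qed.

(** * What a solvabilizer determines *)

Lemma card_fixed_points x : x != 1 -> (#|[set P in Om | x \in P]| <= 2)%N.
Proof.
move=> ntx; rewrite leqNgt; apply/negP => /card_gt2P[P [R [S [[]]]]].
rewrite !inE => /andP[OP Px] /andP[OR Rx] /andP[OS Sx] [PR RS SP].
by case/eqP: ntx; apply: (third_point OP OR OS) => //; rewrite eq_sym.
Qed.

(** This reads the fixed points of [x] off its solvabilizer. If [x] moves [P], take [R] and [h] != 1
    in [P :&: R]: by [Sol_semisimple], [x] in [Sol G h] would fix [P] or [R] or send [P] to [R], all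
    avoided by the choice of [R]. *)
Lemma point_sub_Sol P x : P \in Om -> x \in G -> (P \subset Sol G x) = (x \in P).
Proof.
move=> OP Gx; apply/idP/idP => [sPS|Px]; last first.
  apply/subsetP => y Py; have [P' PE] := point_group OP.
  by apply: (@sub_Sol P'); rewrite -PE ?solvable_point ?point_sub.
case: (boolP (x \in P)) => // nPx.
have ntx : x != 1 by apply: contraNneq nPx => ->; apply: point1.
(* At most four of the q^2 + 1 points are to be avoided: [P], [P :^ x] and the fixed points of
   [x]. *)
have [R OR /and3P[RP RPx nRx]] : exists2 R, R \in Om & [&& R != P, R != P :^ x & x \notin R].
  case: (boolP [exists R in Om, [&& R != P, R != P :^ x & x \notin R]]) => [/exists_inP[R]|no].
    by exists R.
  have : Om \subset [set P; P :^ x] :|: [set R in Om | x \in R].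
    apply/subsetP => R OR; apply: contraR no; rewrite !inE !negb_or => /andP[/andP[h1 h2] h3].
    by apply/exists_inP; exists R; rewrite // h1 h2; rewrite OR in h3.
  move/subset_leq_card; rewrite card_points => /leq_trans/(_ (leq_card_setU _ _)).
  have := card_fixed_points ntx; rewrite cards2; move: #|[set _ in _ | _]| (_ != _) q_gt2.
  clear; case: (q) => [|[|[|r]]] // n b; rewrite !expnS !expn0; case: b; lia.
rewrite eq_sym in RP.
have [h] : exists h, h \in (P :&: R)^#.
  by apply: split_torus_nt; apply/split_toriP; exists P, R.
rewrite !inE => /and3P[nth Ph Rh]; have Gh : h \in G by apply: (subsetP (point_sub OP)).
have : x \in Sol G h by rewrite -Sol_sym // (subsetP sPS).
rewrite (Sol_semisimple OP OR RP Ph Rh nth) !in_setU (negPf nPx) (negPf nRx) /= => Nx.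
case: (norm_split OP OR RP Nx) => -[E E'].
  by move: nPx; rewrite -(point_fixed OP Gx) E eqxx.
by rewrite E eqxx in RPx.
Qed.

Lemma semisimple_cent P R x : P \in Om -> R \in Om -> P != R -> x \in P -> x \in R ->
  x != 1 -> 'C_G[x] = P :&: R.
Proof.
move=> OP OR PR Px Rx ntx; have Gx : x \in G by apply: (subsetP (point_sub OP)).
apply/setP => y; apply/idP/idP => [/setIP[Gy /cent1P cyx]|].
  case: (pair_permute OP OR PR Px Rx ntx Gy
    (fixed_pointJ OP Gy cyx Px) (fixed_pointJ OR Gy cyx Rx)) => -[E E'].
    by rewrite inE -(point_fixed OP Gy) -(point_fixed OR Gy) E E' !eqxx.
  have [_ inv] := swap_inverts OP OR PR Gy E E'.
  have := inv x; rewrite inE Px Rx => /(_ isT).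
  rewrite (conjg_fixP _); last exact/commgP/commute_sym.
  move=> xx; have Ix : x \in I.
    by rewrite inE Gx ntx {1}xx mulVg eqxx.
  have Dx : x \in D2 by apply/semisimpleP; exists P, R.
  by case/negP: (semisimple_nunipotent Dx); apply: inv_unipotent.
have [K KE abK] := pair_group OP OR PR; move=> Ky.
have Gy : y \in G by apply: (subsetP (point_sub OP)); case/setIP: Ky.
rewrite inE Gy; apply/cent1P; apply: (centsP abK); rewrite -KE // inE Px //.
Qed.

Lemma O2_nfix P R x : P \in Om -> x \in 'O_2(P) -> x != 1 -> R \in Om -> R != P ->
  x \notin R.
Proof. by move=> OP Ux ntx OR; apply: contraNN => Rx; rewrite (O2_fix OP OR Ux ntx Rx). Qed.

Lemma exists_involution : exists t, t \in I.
Proof.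
apply/set0Pn; rewrite -card_gt0 card_involutions muln_gt0 /=.
by move: q_gt2; case: (q) => [|[]].
Qed.

Lemma exists_other_point P : exists2 R, R \in Om & R != P.
Proof.
have : ~~ (Om \subset [set P]).
  apply/negP => /subset_leq_card; rewrite card_points cards1.
  by move: q_gt2; case: (q) => [|[]].
by case/subsetPn=> R OR; rewrite inE => RP; exists R.
Qed.

(** This separates the label of 1, which is all of [G], from those of semisimple elements and
    derangements. *)
Lemma cent_no_involution x t : x \in D2 \/ x \in D0 -> t \in I -> t \notin 'C_G[x].
Proof.
move=> Dx It; have [Gt ntt tt _] := invP It; apply/negP; case: Dx => [/semisimpleP|Dx Ct].
  case=> P [R [OP OR PR [Px Rx ntx]]]; rewrite (semisimple_cent OP OR PR Px Rx ntx).
  case/setIP=> Pt Rt; have Dt : t \in D2 by apply/semisimpleP; exists P, R.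
  by case/negP: (semisimple_nunipotent Dt); apply: inv_unipotent.
by have := unipotent_nderangement (inv_unipotent It); rewrite (cent_derangement Dx Ct ntt).
Qed.

(** The index 4 found in [tori_structure] yields an element [y] of order 4 normalising a torus, and
    by [order4_conj] every [x] of order 4 is conjugate to [y] or to its inverse. *)
Lemma order4_torus x : x \in D1 -> x * x != 1 -> exists2 A, A \in AA & x \in 'N_G(A).
Proof.
case/bigcupP=> P OP; rewrite in_setD1 => /andP[ntx Ux] nxx.
have [_ _ cl4] := tori_structure.
have [A [_ [AAA _ _ _]]] := tori_two_classes.
have [z Xz AE] := imsetP AAA.
have [y Ny Iyy] : exists2 y, y \in 'N_G(A) & y * y \in I.
  rewrite AE; case: (card_torus_norm Xz) => [c2|[_ //]].
  have := Lagrange (subsetIl G 'N(A)); rewrite -card_conjugates -(cl4 A AAA) AE c2.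
  have n0 : (0 < #|'C_G[z] :^: G|)%N.
    by rewrite card_gt0; apply/set0Pn; exists ('C_G[z] :^ 1); apply: imset_f.
  move/eqP; rewrite eqn_pmul2r // eqn_pmul2r ?cardG_gt0 //.
have [Gyy ntyy y4 _] := invP Iyy; have [Gy _] := setIP Ny.
have nty : y != 1 by apply: contraNneq ntyy => ->; rewrite mulg1.
have /bigcupP[R OR] := four_torsion_unipotent Gy nty y4.
rewrite in_setD1 nty /= => Uy.
have [g Gg xE] := order4_conj OR OP Uy Ux (elimN eqP ntyy) (elimN eqP nxx).
exists (A :^ g); first exact: torusJ.
have Nyg : y ^ g \in 'N_G(A :^ g).
  by move: Ny; rewrite !inE groupJ // Gy /= => Ny; rewrite -!conjsgM -conjgC conjsgM conjSg.
case: xE => -> //; by rewrite conjVg groupV.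
Qed.

(* A complete invariant of [Sol G x], see [Sol_label_inj] and [Sol_of_label]. *)
Definition Sol_label x := if x \in D1 then [set x; x^-1] else 'C_G[x].

Lemma Sol_eq_fix x y P : x \in G -> y \in G -> Sol G x = Sol G y -> P \in Om ->
  (x \in P) = (y \in P).
Proof. by move=> Gx Gy e OP; rewrite -(point_sub_Sol OP Gx) -(point_sub_Sol OP Gy) e. Qed.

Lemma Sol_eq_1 y : y \in G -> Sol G 1 = Sol G y -> y = 1.
Proof.
move=> Gy e; case: (eqVneq y 1) => // nty; have := card_fixed_points nty.
rewrite (_ : [set P in Om | y \in P] = Om).
  by rewrite card_points; move: q_gt2; case: (q) => [|[|]].
apply/setP => P; rewrite inE; case OP: (P \in Om) => //=.
by rewrite -(Sol_eq_fix (group1 G) Gy e OP) point1.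
Qed.

(** For a point [R] other than [P], the involution [x] swaps [R] and [R :^ x], so it lies in
    [Sol G h] for [h] in their torus, and so does [y]. As [y] fixes neither point it swaps them too,
    and [y * x^-1] fixes both [P] and [R]. *)
Lemma Sol_eq_involution P x y : P \in Om -> x \in 'O_2(P) -> y \in 'O_2(P) -> x != 1 -> y != 1 ->
  x * x = 1 -> Sol G x = Sol G y -> y = x.
Proof.
move=> OP Ux Uy ntx nty xx e; have Gx := O2_G OP Ux; have Gy := O2_G OP Uy.
have [R OR RP] := exists_other_point P.
have nRx := O2_nfix OP Ux ntx OR RP.
have nRy := O2_nfix OP Uy nty OR RP.
have ORx := pointJ OR Gx.
have RxP : R :^ x != P.
  have Px := subsetP (O2_sub OP) _ Ux; rewrite -(point_fixed OP Gx) in Px.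
  by rewrite -{1}(eqP Px) (inj_eq (@conjsg_inj _ x)).
have RRx : R != R :^ x by rewrite eq_sym point_fixed.
have nRxy := O2_nfix OP Uy nty ORx RxP.
have nRxx := O2_nfix OP Ux ntx ORx RxP.
have [h] : exists h, h \in (R :&: R :^ x)^#.
  by apply: split_torus_nt; apply/split_toriP; exists R, (R :^ x).
rewrite in_setD1 => /andP[nth /setIP[Rh Rxh]]; have Gh : h \in G by apply: (subsetP (point_sub OR)).
have Sh := Sol_semisimple OR ORx RRx Rh Rxh nth.
have Rxx : (R :^ x) :^ x = R by rewrite -conjsgM xx conjsg1.
have Nx : x \in 'N_G(R :&: R :^ x).
  by rewrite inE Gx; apply/normP; rewrite conjIg Rxx setIC.
have : y \in Sol G h.
  by rewrite -Sol_sym // -e Sol_sym // Sh in_setU Nx orbT.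
rewrite Sh !in_setU (negPf nRy) (negPf nRxy) /= => Ny.
case: (norm_split OR ORx RRx Ny) => -[E E'].
  by case/negP: nRy; rewrite -(point_fixed OR Gy) E.
have Uyx : y * x^-1 \in 'O_2(P) by rewrite groupM ?groupV.
case: (eqVneq (y * x^-1) 1) => [/eqP|nt]; first by rewrite -eq_mulgV1 => /eqP.
case/negP: (O2_nfix OP Uyx nt OR RP).
by rewrite -(point_fixed OR) ?groupM ?groupV // conjsgM E conjsgK.
Qed.

(** An [x] of order 4 normalises a torus, that is, lies in the solvabilizer of some derangement, and
    so does [y]. The product of their squares is in that torus and fixes [P], so the squares agree
    and [torus_compl4] applies. *)
Lemma Sol_eq_unipotent P x y : P \in Om -> x \in 'O_2(P) -> y \in 'O_2(P) -> x != 1 -> y != 1 ->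
  Sol G x = Sol G y -> y = x \/ y = x^-1.
Proof.
move=> OP Ux Uy ntx nty e; have Gx := O2_G OP Ux; have Gy := O2_G OP Uy.
case: (eqVneq (x * x) 1) => [xx|nxx].
  by left; apply: (Sol_eq_involution OP).
case: (eqVneq (y * y) 1) => [yy|nyy].
  by left; apply/esym; apply: (Sol_eq_involution OP).
have [A AAA Nx] := order4_torus (O2_unipotent OP Ux ntx) nxx.
have [z Xz AE] := imsetP AAA; rewrite AE in Nx; have [Dz _] := realP _ Xz.
have Ny : y \in 'N_G('C_G[z]).
  have Gz := derangementG Dz.
  by rewrite -(Sol_derangement Xz) (Sol_sym Gz Gy) -e -(Sol_sym Gz Gx) (Sol_derangement Xz).
have Ixx : x * x \in I by rewrite inE groupM // nxx (O2_sq OP Ux) /=.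
have Iyy : y * y \in I by rewrite inE groupM // nyy (O2_sq OP Uy) /=.
have [_ nx] := setIP Nx; have [_ ny] := setIP Ny.
have xy : y * y = x * x.
  have nxx' : x * x \in 'N('C_G[z]) by rewrite groupM.
  have nyy' : y * y \in 'N('C_G[z]) by rewrite groupM.
  have Cm := torus_inv_mul Xz Iyy Ixx nyy' nxx'.
  have /eqP : y * y * (x * x) = 1.
    by apply: (torus_point Xz OP Cm); rewrite (subsetP (O2_sub OP)) ?groupM.
  by have [_ _ _ {1}<-] := invP Ixx; rewrite -eq_mulgV1 => /eqP.
have nxx' : x * x \in 'N('C_G[z]) by rewrite groupM.
exact: (torus_compl4 Xz Ixx nxx' Nx Ny).
Qed.

(** The fixed points, known by [Sol_eq_fix], give the type of [x], and its label if [x] is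
    semisimple. If both are derangements, [y] normalises ['C_G[x]], hence belongs to it. *)
Lemma Sol_label_inj x y : x \in G -> y \in G -> Sol G x = Sol G y -> Sol_label x = Sol_label y.
Proof.
move=> Gx Gy e; have fixE := Sol_eq_fix Gx Gy e.
have [D0X0 _ _] := tori_structure.
case: (eqVneq x 1) => [x1|ntx]; first by rewrite x1 in e *; rewrite (Sol_eq_1 Gy e).
case: (eqVneq y 1) => [y1|nty]; first by rewrite y1 in e *; rewrite (Sol_eq_1 Gx (esym e)).
have uni a b P : P \in Om -> a \in 'O_2(P) -> a != 1 -> b != 1 -> b \in G ->
    (forall R, R \in Om -> (a \in R) = (b \in R)) -> b \in 'O_2(P).
  move=> OP Ua nta ntb Gb ab; have Pb : b \in P by rewrite -ab // (subsetP (O2_sub OP)).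
  apply: contraTT Pb => nUb; apply/negP => Pb.
  have [R OR [RP Rb]] := O2_or_pair OP Pb nUb; rewrite -ab // in Rb.
  by case/eqP: RP; apply: O2_fix Rb.
have uni2 a b : a \in D1 -> a != 1 -> b != 1 -> b \in G ->
    (forall R, R \in Om -> (a \in R) = (b \in R)) ->
    exists2 P, P \in Om & a \in 'O_2(P) /\ b \in 'O_2(P).
  case/bigcupP=> P OP; rewrite in_setD1 => /andP[_ Ua] nta ntb Gb ab; exists P => //.
  by split=> //; apply: (uni a).
rewrite /Sol_label; case: (boolP (x \in D1)) => [Dx|nDx].
  have [P OP [Ux Uy]] := uni2 x y Dx ntx nty Gy fixE.
  rewrite (O2_unipotent OP Uy nty).
  by case: (Sol_eq_unipotent OP Ux Uy ntx nty e) => ->; rewrite ?invgK // setUC.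
case: (boolP (y \in D1)) => [Dy|nDy].
  have fixE' R : R \in Om -> (y \in R) = (x \in R) by move=> OR; rewrite fixE.
  have [P OP [Uy Ux]] := uni2 y x Dy nty ntx Gx fixE'.
  by case/negP: nDx; apply: O2_unipotent Ux ntx.
case: (element_types Gx) => [/eqP|||Dx].
- by rewrite (negPf ntx).
- by rewrite (negPf nDx).
- case/semisimpleP=> P [R [OP OR PR [Px Rx _]]].
  rewrite (semisimple_cent OP OR PR Px Rx ntx).
  by rewrite (semisimple_cent OP OR PR _ _ nty) // -fixE.
have Dy : y \in D0.
  rewrite inE Gy; apply/forall_inP => P OP; rewrite -fixE //.
  exact: derangementP.
rewrite D0X0 in Dx; have Xy := Dy; rewrite D0X0 in Xy.
rewrite (Sol_derangement Dx) (Sol_derangement Xy) in e.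
have Ny : y \in 'N_G('C_G[x]).
  by rewrite e inE Gy (subsetP (normG _)) // inE Gy cent1id.
have Cy := torus_norm_derangement Dx Ny Dy.
by have [_ ->] := torus_cent Dx Cy nty.
Qed.

(** The label shows the type: only that of a unipotent element omits 1, and among the others only
    that of 1 contains an involution. *)
Lemma Sol_of_label x y : x \in G -> y \in G -> Sol_label x = Sol_label y -> Sol G x = Sol G y.
Proof.
move=> Gx Gy; rewrite /Sol_label; have [D0X0 _ _] := tori_structure.
have unit_nD1 a b : a \in D1 -> [set a; a^-1] <> 'C_G[b].
  case/bigcupP=> P _; rewrite in_setD1 => /andP[nta _] E.
  have : 1 \in [set a; a^-1] by rewrite E group1.
  by rewrite !inE !(eq_sym 1) invg_eq1 orbb (negPf nta).
case: (boolP (x \in D1)) => Dx; case: (boolP (y \in D1)) => Dy E.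
- have : x \in [set y; y^-1] by rewrite -E set21.
  by case/set2P=> ->; rewrite ?SolV.
- by case: (unit_nD1 x y Dx).
- by case: (unit_nD1 y x Dy).
have tyI a : a \in G -> a \notin D1 -> a <> 1 -> a \in D2 \/ a \in D0.
  by move=> Ga nDa nta; case: (element_types Ga) => // h; [rewrite h in nDa | left | right].
have [t It] := exists_involution; have [Gt _ _ _] := invP It.
have C1 : t \in 'C_G[1] by rewrite inE Gt; apply/cent1P/commute1.
case: (eqVneq x 1) => [x1|/eqP ntx].
  case: (eqVneq y 1) => [->|/eqP nty]; first by rewrite x1.
  by have := cent_no_involution (tyI y Gy Dy nty) It; rewrite -E x1 C1.
case: (eqVneq y 1) => [y1|/eqP nty].
  by have := cent_no_involution (tyI x Gx Dx ntx) It; rewrite E y1 C1.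
have Cy : y \in 'C_G[x] by rewrite E inE Gy cent1id.
case: (tyI x Gx Dx ntx) => [/semisimpleP[P [R [OP OR PR [Px Rx _]]]]|Dx0].
  move: Cy; rewrite (semisimple_cent OP OR PR Px Rx (introN eqP ntx)) => /setIP[Py Ry].
  by rewrite !(Sol_semisimple OP OR PR) //; apply/eqP.
rewrite D0X0 in Dx0; have [Xy _] := torus_cent Dx0 Cy (introN eqP nty).
by rewrite !Sol_derangement // E.
Qed.

(** * Counting the labels *)

Lemma Sol_label_unipotent x : x \in D1 -> Sol_label x = [set x; x^-1].
Proof. by rewrite /Sol_label => ->. Qed.

Lemma Sol_label_other x : x \notin D1 -> Sol_label x = 'C_G[x].
Proof. by rewrite /Sol_label => /negPf->. Qed.

Lemma nunipotent1 : 1 \notin D1.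
Proof. by apply/bigcupP => -[P _]; rewrite in_setD1 eqxx. Qed.

Lemma inv_sub_unipotent : I \subset D1.
Proof. by apply/subsetP => t; apply: inv_unipotent. Qed.

Lemma Sol_label_inv t : t \in I -> Sol_label t = [set t].
Proof.
move=> It; have [_ _ _ tV] := invP It.
by rewrite Sol_label_unipotent ?inv_unipotent // tV setUid.
Qed.

Lemma card_label_inv : #|Sol_label @: I| = #|I|.
Proof.
apply: card_in_imset => s t Is It; rewrite !Sol_label_inv // => E.
by apply/set1P; rewrite -E set11.
Qed.

(** The labels {x, x^-1} partition the elements of order 4 into pairs. *)
Lemma card_label_order4 : #|D1 :\: I| = (#|Sol_label @: (D1 :\: I)| * 2)%N.
Proof.
pose L := Sol_label @: (D1 :\: I).
have LP x : x \in D1 :\: I -> [/\ Sol_label x = [set x; x^-1], x != x^-1 & x^-1 \in D1 :\: I].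
  case/setDP=> Dx nIx; have Gx := unipotentG Dx.
  have [P OP] := bigcupP Dx; rewrite in_setD1 => /andP[ntx Ux].
  have nxx : x * x != 1 by apply: contra nIx => xx; rewrite inE Gx ntx.
  split; first exact: Sol_label_unipotent.
    by rewrite eq_sym eq_invg_mul.
  rewrite in_setD (O2_unipotent OP (x := x^-1)) ?groupV ?invg_eq1 // andbT.
  by apply: contra nIx; rewrite !inE groupV invg_eq1 -invMg invg_eq1.
have E : D1 :\: I = \bigcup_(S in L) S.
  apply/setP => x; apply/idP/bigcupP => [Dx|[_ /imsetP[y Dy ->]]].
    by exists (Sol_label x); [apply: imset_f | have [-> _ _] := LP x Dx; rewrite set21].
  by have [-> _ DyV] := LP y Dy; case/set2P=> ->.
rewrite {1}E card_bigcup_disjoint => [|_ _ /imsetP[x Dx ->] /imsetP[y Dy ->] z].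
  rewrite -sum_nat_const; apply: eq_bigr => _ /imsetP[x Dx ->].
  by have [-> nx _] := LP x Dx; rewrite cards2 nx.
have [-> _ _] := LP x Dx; have [-> _ _] := LP y Dy.
case/set2P=> -> /set2P[] e.
- by rewrite e.
- by rewrite e invgK setUC.
- by rewrite -e invgK setUC.
- by rewrite (invg_inj e).
Qed.

Lemma label_semisimples : Sol_label @: D2 = KK.
Proof.
apply/setP => K; apply/imsetP/idP => [[x Dx ->]|KKK].
  rewrite Sol_label_other ?semisimple_nunipotent //.
  have [P [R [OP OR PR [Px Rx ntx]]]] := semisimpleP _ Dx.
  by rewrite (semisimple_cent OP OR PR Px Rx ntx); apply/split_toriP; exists P, R.
have [x Kx] := split_torus_nt KKK; have Dx : x \in D2 by apply/bigcupP; exists K.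
exists x => //; rewrite Sol_label_other ?semisimple_nunipotent //.
have [P [R [OP OR PR KE]]] := split_toriP _ KKK.
move: Kx; rewrite KE in_setD1 => /andP[ntx /setIP[Px Rx]].
by rewrite (semisimple_cent OP OR PR Px Rx ntx).
Qed.

Lemma label_derangements : Sol_label @: D0 = AA.
Proof.
have [-> _ _] := tori_structure; apply: eq_in_imset => x /realP[Dx _].
by apply: Sol_label_other; apply: contraL Dx; apply: unipotent_nderangement.
Qed.

Lemma label_disjoint (S T : {set gT}) : S \subset G -> T \subset G ->
  (forall x y, x \in S -> y \in T -> Sol_label x <> Sol_label y) ->
  [disjoint Sol_label @: S & Sol_label @: T].
Proof.
move=> sS sT h; rewrite -setI_eq0; apply/eqP/setP => L; rewrite in_setI in_set0.
by apply/andP => -[/imsetP[x Sx ->] /imsetP[y Ty]]; apply: h.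
Qed.

Lemma label1_unipotent x : (1 \in Sol_label x) = (x \notin D1).
Proof.
case: (boolP (x \in D1)) => Dx; last by rewrite Sol_label_other ?group1.
rewrite Sol_label_unipotent // !inE !(eq_sym 1) invg_eq1 orbb.
by apply: contraTF Dx => /eqP ->; apply: nunipotent1.
Qed.

Lemma card_Solv : #|Solv G| = ((3 * q ^ 4 + q ^ 3 - q ^ 2 + q) %/ 2)%N.
Proof.
have [D0X0 cAA _] := tori_structure.
have -> : #|Solv G| = #|Sol_label @: G|.
  by apply: card_imset_eq => x y Gx Gy; split; [exact: Sol_of_label | exact: Sol_label_inj].
have sD2 : D2 \subset G by apply/subsetP; apply: semisimpleG.
have sD1 : D1 \subset G by apply/subsetP; apply: unipotentG.
have sD0 : D0 \subset G by apply/subsetP; apply: derangementG.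
have sI : I \subset G by apply: subset_trans inv_sub_unipotent sD1.
have s4 : D1 :\: I \subset G by apply: subset_trans (subsetDl _ _) sD1.
have s1 : [set 1] \subset G by rewrite sub1set group1.
have n2 x : x \in D2 -> x \notin D1 by apply: semisimple_nunipotent.
have n0 x : x \in D0 -> x \notin D1 by apply: contraL; apply: unipotent_nderangement.
have [t It] := exists_involution; have [Gt _ _ _] := invP It.
have t1 : t \in Sol_label 1.
  by rewrite Sol_label_other ?nunipotent1 // inE Gt; apply/cent1P/commute1.
have d12 : [disjoint Sol_label @: [set 1] & Sol_label @: D2].
  apply: label_disjoint => // _ x /set1P -> Dx E; move: t1; rewrite E Sol_label_other ?n2 //.
  by apply/negP/cent_no_involution; [left | ].
have d120 : [disjoint Sol_label @: ([set 1] :|: D2) & Sol_label @: D0].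
  apply: label_disjoint => // [|x y /setUP[/set1P ->|Dx] Dy E]; first by rewrite subUset s1.
    move: t1; rewrite E Sol_label_other ?n0 //.
    by apply/negP/cent_no_involution; [right | ].
  have Cx : x \in 'C_G[y].
    rewrite -(Sol_label_other (n0 _ Dy)) -E Sol_label_other ?n2 // inE cent1id.
    by rewrite (subsetP sD2).
  have ntx : x != 1 by case/semisimpleP: Dx => P [R [_ _ _ []]].
  by have := semisimple_nderangement Dx; rewrite (cent_derangement Dy Cx ntx).
have dI4 : [disjoint Sol_label @: I & Sol_label @: (D1 :\: I)].
  apply: label_disjoint => // s x Is /setDP[Dx nIx];
    rewrite Sol_label_inv // Sol_label_unipotent // => E.
  have : x \in [set s] by rewrite E set21.
  by move/set1P=> xs; rewrite xs Is in nIx.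
have sI4 : I :|: D1 :\: I = D1.
  apply/setP => x; rewrite in_setU in_setD.
  by case: (boolP (x \in I)) => [/inv_unipotent ->|].
have dall : [disjoint Sol_label @: (([set 1] :|: D2) :|: D0) & Sol_label @: D1].
  apply: label_disjoint => // [|x y Sx Dy E]; first by rewrite !subUset s1 sD2.
  have : 1 \in Sol_label y; last by rewrite label1_unipotent Dy.
  rewrite -E label1_unipotent; case/setUP: Sx => [/setUP[/set1P ->|]|].
  - exact: nunipotent1.
  - exact: n2.
  - exact: n0.
have -> : gval G = (([set 1] :|: D2) :|: D0) :|: D1.
  apply/eqP; rewrite eqEsubset; apply/andP; split; last by rewrite !subUset s1 sD2 sD0.
  apply/subsetP => x Gx.
  rewrite !in_setU in_set1.
  by case: (element_types Gx) => [->|->|->|->]; rewrite ?eqxx ?orbT.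
have cU (S T : {set gT}) : [disjoint Sol_label @: S & Sol_label @: T] ->
    #|Sol_label @: (S :|: T)| = (#|Sol_label @: S| + #|Sol_label @: T|)%N.
  by rewrite imsetU cardsU -setI_eq0 => /eqP ->; rewrite cards0 subn0.
rewrite cU // (cU _ D0) // (cU _ D2) // -sI4 (cU I) //.
rewrite imset_set1 cards1 label_semisimples label_derangements card_label_inv.
apply: (arith_Solv q_gt2 card_split_tori cAA card_involutions _ card_label_order4).
rewrite -card_unipotents -[in RHS]sI4 cardsU.
suff -> : I :&: (D1 :\: I) = set0 by rewrite cards0 subn0.
by apply/setP => x; rewrite in_setI in_setD in_set0; case: (x \in I).
Qed.

End SplitBN.

(** * The matrices of the Suzuki group *)

Section SuzukiMatrices.
Import GRing.Theory.
Local Open Scope ring_scope.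
Variables (F : finFieldType) (p : nat).
Hypotheses (p_gt2 : (2 < p)%N) (odd_p : odd p) (cardF : #|F| = (2 ^ p)%N).
Local Notation th := (@sz_theta F p).
Local Notation m := (sz_m p).
Local Notation Tm := (@sz_T F p).
Local Notation Dm := (@sz_D F p).
Local Notation W := (sz_W F).

(** * The field and the map theta *)

Lemma char2 : 2 \in [pchar F].
Proof. exact: card_finPcharP cardF _. Qed.

Lemma two0 : 2%:R = 0 :> F.
Proof. by case/andP: char2 => _ /eqP. Qed.

Lemma addxx (x : F) : x + x = 0.
Proof. by rewrite -mulr2n -mulr_natl two0 mul0r. Qed.

Lemma addr_eq0_2 (x y : F) : (x + y == 0) = (x == y).
Proof. by rewrite -(inj_eq (addIr y)) -addrA addxx addr0 add0r. Qed.

(* An identity in characteristic 2 holds over the integers up to twice [h]; giving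
   [h] makes it accessible to [ring] and [field]. *)
Lemma eq_mod2 (h x y : F) : x = y + 2%:R * h -> x = y.
Proof. by rewrite two0 mul0r addr0. Qed.

Lemma sqr_inj (x y : F) : x ^+ 2 = y ^+ 2 -> x = y.
Proof.
move=> xy; apply/eqP; rewrite -addr_eq0_2 -sqrf_eq0.
have -> : (x + y) ^+ 2 = x ^+ 2 + y ^+ 2 by apply: (eq_mod2 (h := x * y)); ring.
by rewrite xy addxx.
Qed.

Lemma thD x y : th (x + y) = th x + th y.
Proof. by rewrite /sz_theta exprDn_pchar // pnatX /= (pnatE _ (isT : prime 2)) char2. Qed.

Lemma thM x y : th (x * y) = th x * th y.
Proof. exact: exprMn. Qed.

Lemma th0 : th 0 = 0.
Proof. by rewrite /sz_theta expr0n expn_eq0. Qed.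

Lemma th1 : th 1 = 1.
Proof. exact: expr1n. Qed.

Lemma thV x : th x^-1 = (th x)^-1.
Proof. exact: exprVn. Qed.

Lemma thX x n : th (x ^+ n) = th x ^+ n.
Proof. by rewrite /sz_theta -!exprM mulnC. Qed.

(** Theta is a square root of Frobenius: 2 (m + 1) = p + 1 as [p] is odd, and x^(2^p) = x. *)
Lemma th_th x : th (th x) = x ^+ 2.
Proof.
rewrite /sz_theta -exprM -expnD.
have -> : (m.+1 + m.+1 = p + 1)%N.
  by rewrite /sz_m addSn addnS addnn -[in RHS](odd_double_half p) odd_p add1n addn1.
by rewrite expnD -cardF exprM expf_card.
Qed.

Lemma th_eq0 x : (th x == 0) = (x == 0).
Proof. by rewrite expf_eq0 expn_gt0. Qed.

(** A fixed point of theta is fixed by its square, so x^2 = x. *)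
Lemma th_fix x : th x = x -> x = 0 \/ x = 1.
Proof.
move=> e; have := th_th x; rewrite !e => /eqP;
  rewrite expr2 -{1}[x]mulr1 -subr_eq0 -mulrBr mulf_eq0 subr_eq0.
by case/orP=> /eqP; [left | right].
Qed.

Lemma th_half (k : F) : th k = (k ^+ (2 ^ m)) ^+ 2.
Proof. by rewrite /sz_theta expnS mulnC exprM. Qed.

(** * The generating matrices and their relations *)

(** A singular matrix is sent to the default value 1; [gl4E] certifies invertibility by an explicit
    inverse. *)
Definition gl4 (M : 'M[F]_4) : {'GL_4[F]} := insubd (1%g : {'GL_4[F]}) M.

Lemma gl4E M N : M *m N = 1%:M -> N *m M = 1%:M -> GLval (gl4 M) = M.
Proof. by move=> MN NM; apply: insubdK; apply/unitrP; exists N; split. Qed.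

Lemma GL_inj (g h : {'GL_4[F]}) : GLval g = GLval h -> g = h.
Proof. exact: val_inj. Qed.

Lemma sz_TM a b c d : Tm a b *m Tm c d = Tm (a + c) (b + d + th a * c).
Proof.
apply/matrixP => i j; rewrite !mxE !big_ord_recl big_ord0 !mxE.
rewrite !(thD, thM, th_th).
case: i => -[|[|[|[|]]]] // ?; case: j => -[|[|[|[|]]]] // ? /=; try ring.
  apply/esym/(eq_mod2 (h := a ^+ 2 * th c + a * c * th a + a * c * th c + c ^+ 2 * th a)).
  by ring.
by apply/esym/(eq_mod2 (h := c * th a)); ring.
Qed.

Lemma sz_T00 : Tm 0 0 = 1%:M.
Proof.
apply/matrixP => i j; rewrite !mxE th0.
by case: i => -[|[|[|[|]]]] // ?; case: j => -[|[|[|[|]]]] // ? /=;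
  rewrite ?mulr0 ?expr0n ?addr0 ?mul0r.
Qed.

Definition szT a b := gl4 (Tm a b).

Lemma szTE a b : GLval (szT a b) = Tm a b.
Proof.
apply: (@gl4E _ (Tm a (b + a * th a))); rewrite sz_TM -sz_T00 addxx; congr (Tm _ _).
  by apply: (eq_mod2 (h := b + a * th a)); ring.
by apply: (eq_mod2 (h := b + a * th a)); ring.
Qed.

Lemma szTM a b c d : (szT a b * szT c d)%g = szT (a + c) (b + d + th a * c).
Proof. by apply: GL_inj; rewrite GL_MxE !szTE sz_TM. Qed.

Lemma szT1 : szT 0 0 = 1%g.
Proof. by apply: GL_inj; rewrite szTE sz_T00. Qed.

Lemma szTV a b : (szT a b)^-1%g = szT a (b + a * th a).
Proof.
apply: mulg1_eq; rewrite szTM -szT1 addxx; congr (szT _ _).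
by apply: (eq_mod2 (h := b + a * th a)); ring.
Qed.

Lemma szT_inj a b c d : szT a b = szT c d -> a = c /\ b = d.
Proof.
move=> e; have := szTE a b; rewrite e szTE => /matrixP E.
by have := E 1 0; have := E 2%:R 0; rewrite !mxE.
Qed.

Definition szD (k : F) := gl4 (Dm k).

Lemma szDE k : k != 0 -> GLval (szD k) = Dm k.
Proof.
move=> nk; apply: (@gl4E _ (Dm k^-1)); rewrite mulmx_diag -diag_const_mx; congr diag_mx;
  apply/rowP => i; rewrite !mxE; case: i => -[|[|[|[|]]]] // ? /=;
  by rewrite !exprVn ?invrK ?mulfV ?mulVf ?expf_neq0.
Qed.

Lemma sz_DM k l : Dm k *m Dm l = Dm (k * l).
Proof.
rewrite mulmx_diag; congr diag_mx; apply/rowP => i; rewrite !mxE !exprMn.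
by case: i => -[|[|[|[|]]]] // ? /=; rewrite ?invfM.
Qed.

Lemma szDM k l : k != 0 -> l != 0 -> (szD k * szD l)%g = szD (k * l).
Proof. by move=> nk nl; apply: GL_inj; rewrite GL_MxE !szDE ?mulf_neq0 ?sz_DM. Qed.

Lemma sz_D1 : Dm 1 = 1%:M.
Proof.
rewrite -diag_const_mx; congr diag_mx; apply/rowP => i; rewrite !mxE !expr1n.
by case: i => -[|[|[|[|]]]] // ? /=; rewrite ?invr1.
Qed.

Lemma szD1 : szD 1 = 1%g.
Proof. by apply: GL_inj; rewrite szDE ?oner_neq0 ?sz_D1. Qed.

Lemma szDV k : k != 0 -> (szD k)^-1%g = szD k^-1.
Proof. by move=> nk; apply: mulg1_eq; rewrite szDM ?invr_eq0 // mulfV ?szD1. Qed.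

Lemma szD_inj k l : k != 0 -> l != 0 -> szD k = szD l -> k = l.
Proof.
move=> nk nl e; have := szDE nk; rewrite e szDE // => /matrixP E.
have := E 0 0; have := E 1 1; rewrite !mxE /= !mulr1n => e1.
rewrite !exprD !expr1 e1 => h; apply/esym/(mulIf _ h).
by rewrite expf_neq0.
Qed.

Lemma sz_WE i j : W i j = (j == rev_ord i)%:R.
Proof.
rewrite mxE -(inj_eq val_inj) /=.
by case: i => -[|[|[|[|]]]] // ?; case: j => -[|[|[|[|]]]] // ? /=.
Qed.

Lemma sz_WM (M : 'M[F]_4) : W *m M = \matrix_(i, j) M (rev_ord i) j.
Proof.
apply/matrixP => i j; rewrite !mxE (bigD1 (rev_ord i)) //= sz_WE eqxx mul1r.
by rewrite big1 ?addr0 // => k /negPf nk; rewrite sz_WE nk mul0r.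
Qed.

Lemma sz_MW (M : 'M[F]_4) : M *m W = \matrix_(i, j) M i (rev_ord j).
Proof.
apply/matrixP => i j; rewrite !mxE (bigD1 (rev_ord j)) //= sz_WE rev_ordK eqxx mulr1.
rewrite big1 ?addr0 // => k nk; rewrite sz_WE -(inj_eq rev_ord_inj) rev_ordK.
by rewrite eq_sym (negPf nk) mulr0.
Qed.

Lemma sz_WW : W *m W = 1%:M.
Proof. by apply/matrixP => i j; rewrite sz_WM mxE sz_WE rev_ordK mxE eq_sym. Qed.

Definition szW := gl4 W.

Lemma szWE : GLval szW = W.
Proof. by apply: gl4E; apply: sz_WW. Qed.

Lemma szWW : (szW * szW)%g = 1%g.
Proof. by apply: GL_inj; rewrite GL_MxE szWE sz_WW. Qed.

Lemma szD_conj_W k : k != 0 -> (szD k ^ szW)%g = (szD k)^-1%g.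
Proof.
move=> nk; rewrite conjgE; apply: (mulgI szW); rewrite mulKVg szDV //.
apply: GL_inj; rewrite !GL_MxE !szDE ?invr_eq0 // szWE sz_WM sz_MW.
apply/matrixP => i j;
  rewrite !mxE -(inj_eq val_inj) -(inj_eq (val_inj : injective (@nat_of_ord 4))) /=.
case: i => -[|[|[|[|]]]] // ?; case: j => -[|[|[|[|]]]] // ? /=;
  rewrite ?mulr0n ?mulr1n // ?exprVn ?invrK //.
Qed.

Lemma szTD a b k : k != 0 -> (szT a b * szD k)%g = (szD k * szT (k * a)%R (k * th k * b)%R)%g.
Proof.
move=> nk; apply: GL_inj; rewrite !GL_MxE szDE // !szTE mul_diag_mx mul_mx_diag.
apply/matrixP => i j; rewrite !mxE !(thM, thD, th_th) !exprD expr1 (th_half k).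
(* Theta of [k] is the square of K = k^(2^m); generalising over [K] leaves rational identities. *)
have := expf_neq0 (2 ^ m) nk; move: (k ^+ _) => K nK.
by case: i => -[|[|[|[|]]]] // ?; case: j => -[|[|[|[|]]]] // ? /=; field; rewrite ?nk ?nK.
Qed.

(* [sz_norm a b], [a * th a + b], [a] and [1] are the entries of the last row of
   [Tm a b], the coordinates of a point of the Suzuki-Tits ovoid. *)
Definition sz_norm a b := a ^+ 2 * th a + a * b + th b.
Local Notation nm := sz_norm.

Lemma th_norm a b : th (nm a b) = th a ^+ 2 * a ^+ 2 + th a * th b + b ^+ 2.
Proof. by rewrite /sz_norm !(thD, thM, thX, th_th). Qed.

(* [norm = 0] and hence [th norm = 0] force [y ^+ 2 * th y = 0] for [y = a * th a + b]. *)
Lemma norm_eq0 a b : nm a b = 0 -> a = 0 /\ b = 0.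
Proof.
move=> z0; have Z0 : th (nm a b) = 0 by rewrite z0 th0.
pose y := a * th a + b.
have thy : th y = th a * a ^+ 2 + th b by rewrite /y thD thM th_th.
have y0 : y = 0.
  have : y ^+ 2 * th y = 0.
    have -> : y ^+ 2 * th y = nm a b * th (nm a b) + nm a b ^+ 2 * th a + a * y * th (nm a b).
      rewrite thy th_norm /y /sz_norm; move: (th a) (th b) => A B.
      apply/esym/(eq_mod2 (h := A * (a ^+ 2 * A + B) ^+ 2
        + a * b * (A ^+ 2 * a ^+ 2 + A * B + b ^+ 2 + a * b * A))).
      ring.
    by rewrite Z0 z0 !(mulr0, mul0r, expr0n, addr0).
  by move/eqP; rewrite mulf_eq0 expf_eq0 th_eq0 /= orbb => /eqP.
have a0 : a = 0.
  have : a ^+ 2 * th a = 0.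
    have -> : a ^+ 2 * th a = a * y + th y + nm a b.
      rewrite thy /y /sz_norm; move: (th a) (th b) => A B.
      by apply/esym/(eq_mod2 (h := a ^+ 2 * A + a * b + B)); ring.
    by rewrite y0 z0 th0 mulr0 !addr0.
  by move/eqP; rewrite mulf_eq0 expf_eq0 th_eq0 /= orbb => /eqP.
by split=> //; move: y0; rewrite /y a0 mul0r add0r.
Qed.

(** Both sides have the same square, by [th_half], and squaring is injective. The diagonal entries
    in [bruhat_mx] thus become rational in [z] and theta of [z]. *)
Lemma exp_half_ratio z : z != 0 -> (z ^+ 2 / th z) ^+ (2 ^ m) = th z / z.
Proof.
move=> nz; have nZ : th z != 0 by rewrite th_eq0.
apply: sqr_inj; rewrite -th_half thM thV thX th_th.
by rewrite exprMn exprVn.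
Qed.

(* The last factor on the left is the inverse of the right unipotent factor of
   [W *m Tm a b *m W], which sends [(0, 0, 0, 1)] to a multiple of [(1, a, y, z)]. *)
Lemma bruhat_mx a b : nm a b != 0 ->
  let z := nm a b in
  W *m Tm a b *m W *m Tm ((a * th a + b) / z) (a / z) =
  Tm (b / z) (a / z) *m Dm (z ^+ 2 / th z) *m W.
Proof.
move=> nz z; have nZ : th z != 0 by rewrite th_eq0.
have DE : Dm (z ^+ 2 / th z) = diag_mx (\row_j [:: z; th z / z; z / th z; z^-1]`_j).
  congr diag_mx; apply/rowP => j; rewrite !mxE exprD expr1 (exp_half_ratio nz) -/z.
  by case: j => -[|[|[|[|]]]] // ? /=; field; rewrite nz nZ.
rewrite DE sz_WM (sz_MW (\matrix_(i, j) _)) (sz_MW (_ *m diag_mx _)) mul_mx_diag.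
have nz' := nz; have nZ' := nZ; rewrite /z th_norm in nZ'; rewrite /sz_norm in nz'.
apply/matrixP => i j; rewrite !mxE !big_ord_recl big_ord0 !mxE.
rewrite !(thM, thD, thV, thX, th_th) /z /sz_norm.
(* With theta of [a] and [b] replaced by variables, each entry is a rational identity up to a
   multiple of 2; [Y] and [Z] below are theta of [y] and [z]. *)
move: (th a) (th b) nz' nZ' => A B {DE nZ z}{}nz nZ.
pose z := a ^+ 2 * A + a * b + B; pose Z := A ^+ 2 * a ^+ 2 + A * B + b ^+ 2.
pose y := a * A + b; pose Y := A * a ^+ 2 + B; pose s := a * A * (2%:R * b * Y + a * Z).
case: i => -[|[|[|[|]]]] // ?; case: j => -[|[|[|[|]]]] // ? /=.
- by apply: (eq_mod2 (h := a * y / z + 1 + s / (z * Z))); rewrite /s /y /Y /z /Z; field;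
  rewrite ?exprMn ?nz ?nZ.
- by apply: (eq_mod2 (h := a + y * Y / Z)); rewrite /s /y /Y /z /Z; field; rewrite ?exprMn ?nz ?nZ.
- by apply: (eq_mod2 (h := y)); rewrite /s /y /Y /z /Z; field; rewrite ?exprMn ?nz ?nZ.
- by field; rewrite ?exprMn ?nz ?nZ.
- by apply: (eq_mod2 (h := y / z + b * s / (z ^+ 2 * Z))); rewrite /s /y /Y /z /Z; field;
  rewrite ?exprMn ?nz ?nZ.
- by apply: (eq_mod2 (h := 1 + a * b * A * Y / (z * Z))); rewrite /s /y /Y /z /Z; field;
  rewrite ?exprMn ?nz ?nZ.
- by apply: (eq_mod2 (h := a * b * A / z)); rewrite /s /y /Y /z /Z; field; rewrite ?exprMn ?nz ?nZ.
- by field; rewrite ?exprMn ?nz ?nZ.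
- by apply: (eq_mod2 (h := a / z + a * s / (z ^+ 2 * Z))); rewrite /s /y /Y /z /Z; field;
  rewrite ?exprMn ?nz ?nZ.
- by apply: (eq_mod2 (h := a ^+ 2 * A * Y / (z * Z))); rewrite /s /y /Y /z /Z; field;
  rewrite ?exprMn ?nz ?nZ.
- by apply: (eq_mod2 (h := a * y / z)); rewrite /s /y /Y /z /Z; field; rewrite ?exprMn ?nz ?nZ.
- by field; rewrite ?exprMn ?nz ?nZ.
- by apply: (eq_mod2 (h := s / (z ^+ 2 * Z))); rewrite /s /y /Y /z /Z; field;
  rewrite ?exprMn ?nz ?nZ.
- by apply: (eq_mod2 (h := a * A * Y / (z * Z))); rewrite /s /y /Y /z /Z; field;
  rewrite ?exprMn ?nz ?nZ.
- by apply: (eq_mod2 (h := a ^+ 2 * b * A / z ^+ 2)); rewrite /s /y /Y /z /Z; field;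
  rewrite ?exprMn ?nz ?nZ.
- by apply: (eq_mod2 (h := - (a * b * A * Y / (z * Z)))); rewrite /s /y /Y /z /Z; field;
  rewrite ?exprMn ?nz ?nZ.
Qed.

(** * The subgroups [szQ] and [szH] *)

Definition szQ_set := [set szT x.1 x.2 | x : F * F].
Definition szH_set := [set szD k | k in [set k : F | k != 0]].

Lemma szQ_setP g : reflect (exists a b, g = szT a b) (g \in szQ_set).
Proof.
by apply: (iffP imsetP) => [[[a b] _ ->]|[a [b ->]]]; [exists a, b | exists (a, b)].
Qed.

Lemma szH_setP g : reflect (exists2 k, k != 0 & g = szD k) (g \in szH_set).
Proof.
by apply: (iffP imsetP) => [[k]|[k nk ->]]; [rewrite inE; exists k | exists k; rewrite ?inE].
Qed.

Lemma szQ_group_set : group_set szQ_set.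
Proof.
apply/group_setP; split; first by apply/szQ_setP; exists 0, 0; rewrite szT1.
move=> _ _ /szQ_setP[a [b ->]] /szQ_setP[c [d ->]]; rewrite szTM.
by apply/szQ_setP; do 2 eexists.
Qed.

Lemma szH_group_set : group_set szH_set.
Proof.
apply/group_setP; split; first by apply/szH_setP; exists 1; rewrite ?oner_neq0 ?szD1.
move=> _ _ /szH_setP[k nk ->] /szH_setP[l nl ->]; rewrite szDM //.
by apply/szH_setP; exists (k * l); rewrite ?mulf_neq0.
Qed.

Canonical szQ := Group szQ_group_set.
Canonical szH := Group szH_group_set.

Lemma szQP g : g \in szQ -> exists a b, g = szT a b.
Proof. by move/szQ_setP. Qed.

Lemma szHP g : g \in szH -> exists2 k, k != 0 & g = szD k.
Proof. by move/szH_setP. Qed.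

Lemma mem_szQ a b : szT a b \in szQ.
Proof. by apply/szQ_setP; exists a, b. Qed.

Lemma mem_szH k : k != 0 -> szD k \in szH.
Proof. by move=> nk; apply/szH_setP; exists k. Qed.

Definition szG := <<[set g : {'GL_4[F]} | sz_gen p (GLval g)]>>%G.

Lemma szG_gen : szG = <<szQ :|: szH :|: [set szW]>>%g :> {set {'GL_4[F]}}.
Proof.
congr (<<_>>%g); apply/setP => g; rewrite !in_setU in_set1 in_set -orbA; apply/or3P/or3P.
  case=> [/existsP[a /existsP[b /eqP E]]|/existsP[k /andP[nk /eqP E]]|/eqP E].
  - by constructor 1; apply/szQ_setP; exists a, b; apply: GL_inj; rewrite szTE.
  - by constructor 2; apply/szH_setP; exists k => //; apply: GL_inj; rewrite szDE.
  - by constructor 3; apply/eqP/GL_inj; rewrite szWE.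
case=> [/szQ_setP[a [b ->]]|/szH_setP[k nk ->]|/eqP ->].
- by constructor 1; apply/existsP; exists a; apply/existsP; exists b; rewrite szTE.
- by constructor 2; apply/existsP; exists k; rewrite nk szDE /=.
- by constructor 3; rewrite szWE.
Qed.

Lemma card_szQ : #|szQ| = ((2 ^ p) ^ 2)%N.
Proof.
rewrite card_imset ?card_prod ?cardF ?mulnn // => -[a b] [c d] /= /szT_inj[-> ->].
by [].
Qed.

Lemma card_szH : #|szH| = (2 ^ p).-1.
Proof.
rewrite card_in_imset => [|k l]; last by rewrite !inE; apply: szD_inj.
have -> : [set k : F | k != 0] = [set~ 0] by apply/setP => k; rewrite !inE.
by rewrite cardsC1 cardF.
Qed.

Lemma szT_eq1 a b : szT a b = 1%g <-> a = 0 /\ b = 0.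
Proof.
split=> [|[-> ->]]; last exact: szT1.
by rewrite -szT1 => /szT_inj.
Qed.

(** * Squares and commutation in [szQ] *)

Lemma szT_sq a b : (szT a b * szT a b)%g = szT 0 (a * th a).
Proof. by rewrite szTM !addxx add0r mulrC. Qed.

Lemma mul_th_eq0 a : (a * th a == 0) = (a == 0).
Proof. by rewrite mulf_eq0 th_eq0 orbb. Qed.

(** Applying theta to the hypothesis gives 1 = theta(u) u^2 = u. *)
Lemma mul_th_eq1 u : u * th u = 1 -> u = 1.
Proof.
move=> u1; have : th (u * th u) = 1 by rewrite u1 th1.
by rewrite thM th_th expr2 mulrA (mulrC (th u)) u1 mul1r.
Qed.

Lemma mul_th_inj a c : a * th a = c * th c -> a = c.
Proof.
case: (eqVneq c 0) => [-> /eqP|nc e]; first by rewrite mul0r mul_th_eq0 => /eqP.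
have /mul_th_eq1 ac : a / c * th (a / c) = 1.
  by rewrite thM thV mulrACA e -invfM mulfV // mul_th_eq0.
by rewrite -(divfK nc a) ac mul1r.
Qed.

(** The quotient c / a is fixed by theta, hence 0 or 1. *)
Lemma th_cross a c : a != 0 -> th a * c = th c * a -> c = 0 \/ c = a.
Proof.
move=> na e; have nA : th a != 0 by rewrite th_eq0.
have : th (c / a) = c / a.
  rewrite thM thV; apply/eqP; rewrite eqr_div //; apply/eqP.
  by rewrite -e mulrC.
case/th_fix=> u; [left|right]; rewrite -(divfK na c) u ?mul0r ?mul1r //.
Qed.

(* With [u = c / a] the equation reads [u + th u = 1]; applying [th] to it gives
   [u = u ^+ 2]. *)
Lemma th_trace a c : a != 0 -> th a * c + th c * a <> a * th a.
Proof.
move=> na e; have nA : th a != 0 by rewrite th_eq0.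
pose u := c / a; have u1 : u + th u = 1.
  rewrite /u thM thV addf_div // (mulrC c) e divff // mul_th_eq0 //.
have : th (u + th u) = 1 by rewrite u1 th1.
rewrite thD th_th -u1 => /eqP; rewrite addrC -addr_eq0_2 addrACA addxx addr0 addr_eq0_2.
rewrite expr2 -{3}[u]mulr1 -subr_eq0 -mulrBr mulf_eq0 subr_eq0 => /orP[] /eqP u0.
  by move: u1; rewrite u0 th0 addr0 => /esym/eqP; rewrite oner_eq0.
by move: u1; rewrite u0 th1 addxx => /esym/eqP; rewrite oner_eq0.
Qed.

Lemma szQ_involution a b : (szT a b * szT a b)%g = 1%g <-> a = 0.
Proof.
rewrite szT_sq szT_eq1; split=> [[_ /eqP]|->]; last by rewrite mul0r.
by rewrite mul_th_eq0 => /eqP.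
Qed.

Lemma card_szQ_inv : #|involutions szQ| = (2 ^ p).-1.
Proof.
have -> : involutions szQ = [set szT 0 b | b in [set~ (0 : F)]].
  apply/setP => g; rewrite !in_set;
    apply/and3P/imsetP => [[/szQP[a [b ->]] nt /eqP /szQ_involution a0]|[b]].
    exists b; last by rewrite a0.
    rewrite a0 in nt *; rewrite !inE; apply: contraNneq nt => b0.
    by rewrite b0 szT1.
  rewrite !inE => nb ->; split; first exact: mem_szQ.
    by apply: contraNneq nb => /szT_eq1[_ ->].
  exact/eqP/szQ_involution.
by rewrite card_imset ?cardsC1 ?cardF // => b d /szT_inj[].
Qed.

Lemma szQH_lower g : g \in (szQ * szH)%g -> GLval g 0 1 = 0 /\ GLval g 0 2%:R = 0.
Proof.
case/mulsgP=> _ _ /szQP[a [b ->]] /szHP[k nk ->] ->.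
by rewrite GL_MxE szTE szDE // mul_mx_diag !mxE /= !mul0r.
Qed.

Lemma szT_conjW a b : GLval (szT a b ^ szW)%g = \matrix_(i, j) Tm a b (rev_ord i) (rev_ord j).
Proof.
have WV : szW^-1%g = szW by apply: mulg1_eq; rewrite szWW.
rewrite conjgE WV mulgA !GL_MxE szTE szWE sz_WM sz_MW.
by apply/matrixP => i j; rewrite !mxE.
Qed.

Lemma szT_bruhat a b : szT a b != 1%g -> exists g v,
  [/\ g \in (szQ * szH)%g, v \in szQ & (szW * szT a b * szW = g * szW * v)%g].
Proof.
move=> nt; have nz : sz_norm a b != 0.
  by apply: contraNneq nt => /norm_eq0[-> ->]; rewrite szT1.
have nk : sz_norm a b ^+ 2 / th (sz_norm a b) != 0.
  by rewrite mulf_neq0 ?expf_neq0 ?invr_eq0 ?th_eq0.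
pose v := szT ((a * th a + b) / sz_norm a b) (a / sz_norm a b).
pose u := szT (b / sz_norm a b) (a / sz_norm a b).
exists (u * szD (sz_norm a b ^+ 2 / th (sz_norm a b))%R)%g, v^-1%g; split;
  first by rewrite mem_mulg ?mem_szQ ?mem_szH.
  by rewrite groupV mem_szQ.
apply: (canRL (mulgK v)); apply: GL_inj; rewrite !GL_MxE !szTE szWE szDE //.
exact: bruhat_mx.
Qed.

Lemma card_Solv_szG :
  let q := (2 ^ p)%N in #|Solv szG| = ((3 * q ^ 4 + q ^ 3 - q ^ 2 + q) %/ 2)%N.
Proof.
have sub (A : {set {'GL_4[F]}}) : A \subset szQ :|: szH :|: [set szW] -> A \subset szG.
  by rewrite szG_gen => sA; apply: subset_trans sA (subset_gen _).
apply: (@card_Solv _ szG szQ szH szW).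
- by rewrite pnatX.
- by rewrite (leq_trans _ (leq_pexp2l _ p_gt2)).
- by apply: sub; rewrite -setUA subsetUl.
- by apply: sub; rewrite setUAC subsetUr.
- by rewrite -sub1set sub ?subsetUr.
- by rewrite szG_gen.
- exact: card_szQ.
- exact: card_szH.
- apply/subsetP => _ /szHP[k nk ->]; rewrite inE; apply/subsetP => _ /imsetP[_ /szQP[a [b ->]] ->].
  by rewrite conjgE szTD // mulKg mem_szQ.
- apply/centsP => _ /szHP[k nk ->] _ /szHP[l nl ->].
  by rewrite /commute !szDM // mulrC.
- exact: szWW.
- by move=> _ /szHP[k nk ->]; apply: szD_conj_W.
(* Commuting means k a = a and k theta(k) b = b, so for k != 1 both [a] and [b] vanish. *)
- move=> _ _ /szQP[a [b ->]] /szHP[k nk ->]; rewrite /commute szTD // => /mulgI/szT_inj[ea eb].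
  case: (eqVneq k 1) => [->|nk1]; [by right; rewrite szD1 | left].
  have a0 : a = 0.
    apply/eqP; apply: contraNT nk1 => na; apply/eqP/(mulIf na).
    by rewrite mul1r ea.
  have b0 : b = 0.
    apply/eqP; apply: contraNT nk1 => nb; apply/eqP/mul_th_eq1/(mulIf nb).
    by rewrite mul1r eb.
  by rewrite a0 b0 szT1.
(* Conjugation by [W] reverses rows and columns, so the two vanishing entries are [a] and a theta(a)
   + b. *)
- move=> _ /szQP[a [b ->]] /szQH_lower; rewrite szT_conjW !mxE /= => -[a0].
  by rewrite a0 mul0r add0r => ->; rewrite szT1.
- by move=> _ /szQP[a [b ->]]; apply: szT_bruhat.
- exact: card_szQ_inv.
- move=> _ _ /szQP[a [b ->]] /szQP[c [d ->]] /szQ_involution ->.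
  by rewrite /commute !szTM th0 mul0r mulr0 !addr0 add0r (addrC b).
- by move=> _ /szQP[a [b ->]]; rewrite szT_sq; apply/szQ_involution.
- move=> _ _ /szQP[a [b ->]] /szQP[c [d ->]]; rewrite !szT_sq => /szT_inj[_ /mul_th_inj ->].
  by rewrite szTV szTM addxx; apply/szQ_involution.
- move=> _ _ /szQP[a [b ->]] /szQP[c [d ->]] nab cm.
  have na : a != 0 by apply/eqP => /(szQ_involution a b).
  rewrite /commute !szTM in cm; case/szT_inj: cm => _ e.
  case: (@th_cross a c na); first by move: e; rewrite (addrC d) => /addrI.
    by move=> ->; left; apply/szQ_involution.
  by move=> ->; right; rewrite !szT_sq.
(* Comparing second coordinates in u v = v u^-1 gives the equation excluded by [th_trace]. *)
- move=> _ _ /szQP[a [b ->]] /szQP[c [d ->]] nab.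
  have na : a != 0 by apply/eqP => /(szQ_involution a b).
  rewrite conjgE => /(congr1 (fun g => (szT c d * g)%g));
    rewrite mulKVg szTV !szTM => /szT_inj[_ e].
  apply: (@th_trace a c na); apply/eqP; rewrite -addr_eq0_2; apply/eqP.
  move/eqP: e; rewrite -addr_eq0_2 => /eqP <-.
  by apply: (eq_mod2 (h := - (b + d))); ring.
Qed.

End SuzukiMatrices.

Theorem theorem3p9 (p : nat) (F : finFieldType) :
  prime p -> odd p -> #|F| = 2 ^ p ->
  let q := 2 ^ p in
  #|Solv (Suzuki F p)| = (3 * q ^ 4 + q ^ 3 - q ^ 2 + q) %/ 2.
Proof.
move=> prp oddp cardF; apply: (card_Solv_szG _ oddp cardF).
by rewrite odd_prime_gt2.
Qed.
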